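(* Let $M$ be a connected smooth manifold without boundary, and let $G$ be a discrete group acting smoothly, properly, and effectively on $M$. Let $q\colon M\to M/G$ be the quotient map. If $q$ admits a continuous section (that is, a continuous map $s\colon M/G\to M$ with $q\circ s=\mathrm{id}_{M/G}$), then $G$ is generated by reflections over $M$.
   Context: $M/G$ is the orbit space with the quotient topology. For $g\in G$, $M^g=\{x\in M\mid gx=x\}$ denotes the fixed-point set. An element $r\in G$ is called a reflection over $M$ if some connected component of $M^r$ has codimension one in $M$. (Connected components of $M^g$ are closed submanifolds of $M$.) *)

(* Defs.v *)
From HB Require Import structures.
From mathcomp Require Export all_boot all_order all_algebra.
From mathcomp Require Export all_classical all_reals all_analysis.
From mathcomp Require Export generic_quotient.
Export numFieldNormedType.Exports.

Set Implicit Arguments.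
Unset Strict Implicit.
Unset Printing Implicit Defensive.

Local Open Scope classical_set_scope.
Local Open Scope ring_scope.
Local Open Scope quotient_scope.

(* f is of class C^k on U, meant for U open: the partial derivatives of f of
   order at most k exist and are continuous at every point of U. *)
Fixpoint class_C (R : realType) (m n : nat) (k : nat) (U : set 'rV[R]_m)
    (f : 'rV[R]_m -> 'rV[R]_n) : Prop :=
  {in U, continuous f} /\
  if k is k'.+1 then
    forall i : 'I_m, {in U, forall x, derivable f x (delta_mx 0 i)} /\
                     class_C k' U ('D_(delta_mx 0 i) f)
  else True.

Definition smooth_on (R : realType) (m n : nat) (U : set 'rV[R]_m)
    (f : 'rV[R]_m -> 'rV[R]_n) : Prop :=
  forall k, class_C k U f.

(* A homeomorphism from an open subset of M onto an open subset of R^n; both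
   maps are total functions whose values outside these sets are irrelevant. *)
Record chart (R : realType) (n : nat) (M : topologicalType) := Chart {
  chart_dom : set M;
  chart_map :> M -> 'rV[R]_n;
  chart_inv : 'rV[R]_n -> M;
  chart_dom_open : open chart_dom;
  chart_cod_open : open (chart_map @` chart_dom);
  chart_map_continuous : {in chart_dom, continuous chart_map};
  chart_inv_continuous : {in chart_map @` chart_dom, continuous chart_inv};
  chart_mapK : {in chart_dom, cancel chart_map chart_inv}
}.

Definition smooth_transition (R : realType) (n : nat) (M : topologicalType)
    (c d : chart R n M) : Prop :=
  smooth_on (c @` (chart_dom c `&` chart_dom d)) (d \o chart_inv c).

Record smooth_manifold (R : realType) (n : nat) (M : topologicalType) :=
    SmoothManifold {
  atlas : set (chart R n M);
  atlas_cover : forall x : M, exists2 c, atlas c & chart_dom c x;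
  atlas_smooth : forall c d, atlas c -> atlas d -> smooth_transition c d;
  manifold_hausdorff : hausdorff_space M;
  manifold_second_countable : @second_countable M
}.

(* The charts of the maximal atlas containing the given one. *)
Definition smooth_chart (R : realType) (n : nat) (M : topologicalType)
    (S : smooth_manifold R n M) (c : chart R n M) : Prop :=
  forall d, atlas S d -> smooth_transition c d /\ smooth_transition d c.

Definition smooth_map (R : realType) (m n : nat) (M N : topologicalType)
    (S : smooth_manifold R m M) (T : smooth_manifold R n N) (f : M -> N) :
    Prop :=
  continuous f /\
  forall c d, atlas S c -> atlas T d ->
    smooth_on (c @` (chart_dom c `&` f @^-1` chart_dom d))
              (d \o f \o chart_inv c).

(* C is an embedded submanifold of dimension k: near each of its points it is,
   in a suitable smooth chart, the locus where all coordinates but the first k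
   vanish. *)
Definition submanifold (R : realType) (n : nat) (M : topologicalType)
    (S : smooth_manifold R n M) (k : nat) (C : set M) : Prop :=
  (k <= n)%N /\
  forall x, C x -> exists c : chart R n M,
    [/\ smooth_chart S c, chart_dom c x &
        c @` (chart_dom c `&` C) =
        (c @` chart_dom c) `&`
          [set v | forall i : 'I_n, (k <= i)%N -> v 0 i = 0]].

(* Stated as k + q = n because truncated subtraction would make a point have
   codimension 1 in a 0-manifold. *)
Definition has_codim (R : realType) (n : nat) (M : topologicalType)
    (S : smooth_manifold R n M) (q : nat) (C : set M) : Prop :=
  exists2 k, (k + q = n)%N & submanifold S k C.

Record left_action (G : groupType) (M : Type) := LeftAction {
  act :> G -> M -> M;
  act1 : forall x, act 1%g x = x;
  actM : forall g h x, act (g * h)%g x = act g (act h x)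
}.

Definition smooth_action (R : realType) (n : nat) (M : topologicalType)
    (S : smooth_manifold R n M) (G : groupType) (a : left_action G M) : Prop :=
  forall g, smooth_map S S (a g).

Definition proper_map (X Y : topologicalType) (f : X -> Y) : Prop :=
  forall K : set Y, compact K -> compact (f @^-1` K).

(* Properness of (g, x) |-> (g x, x), with G discrete. *)
Definition proper_action (G : groupType) (M : topologicalType)
    (a : left_action G M) : Prop :=
  proper_map (fun p : discrete_topology G * M => (a p.1 p.2, p.2)).

Definition effective_action (G : groupType) (M : Type)
    (a : left_action G M) : Prop :=
  forall g, (forall x, a g x = x) -> g = 1%g.

Section OrbitSpace.
Variables (G : groupType) (M : topologicalType) (a : left_action G M).

Definition orbit_rel : rel M := fun x y => `[< exists g, a g x = y >].

Lemma orbit_rel_refl : reflexive orbit_rel.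
Proof. by move=> x; apply/asboolP; exists 1%g; exact: act1. Qed.

Lemma orbit_rel_sym : symmetric orbit_rel.
Proof.
suff H x y : orbit_rel x y -> orbit_rel y x by move=> x y; apply/idP/idP => /H.
move=> /asboolP[g <-]; apply/asboolP; exists g^-1%g.
by rewrite -actM mulVg act1.
Qed.

Lemma orbit_rel_trans : transitive orbit_rel.
Proof.
move=> y x z /asboolP[g <-] /asboolP[h <-]; apply/asboolP.
by exists (h * g)%g; exact: actM.
Qed.

Definition orbit_equiv : equiv_rel M :=
  EquivRel orbit_rel orbit_rel_refl orbit_rel_sym orbit_rel_trans.

Definition orbit_space : topologicalType :=
  quotient_topology {eq_quot orbit_equiv}.

Definition orbit_map : M -> orbit_space :=
  \pi_(quotient_topology {eq_quot orbit_equiv}).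

End OrbitSpace.

Definition fixed_points (G : groupType) (M : Type) (a : left_action G M)
    (g : G) : set M :=
  [set x | a g x = x].

(* The base point x lies in the fixed-point set: otherwise the component is
   empty, and the empty set is vacuously a submanifold of every dimension. *)
Definition reflection (R : realType) (n : nat) (M : topologicalType)
    (S : smooth_manifold R n M) (G : groupType) (a : left_action G M)
    (r : G) : Prop :=
  exists2 x, fixed_points a r x &
    has_codim S 1 (connected_component (fixed_points a r) x).

Definition generated_subgroup (G : groupType) (X : set G) : set G :=
  smallest (fun H : set G => group_closed (mem H)) X.

(* Main.v *)
(* Let rho = s \o q, a continuous retraction of M onto a set meeting every orbit
   once, and let H be a subgroup containing the reflections.  The set W of the
   points y = h (rho y) with h in H is closed by properness, and a point of W
   whose isotropy group lies in H is interior to W.  Near x in W, averaging a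
   chart over the finite isotropy group K of x makes K act linearly.  An element
   of K outside H is neither 1 nor a reflection, so its fixed subspace has
   codimension at least 2; these subspaces do not disconnect a ball, so W
   contains a neighbourhood of x.  Hence W = M by connectedness, and comparing
   z = h (rho z) with g z = h' (rho z) at a point z with trivial isotropy gives
   g = h' h^-1 in H.  The codimension of the fixed set of g at a fixed point x is
   the rank of dg - 1 at x, which is constant on components of the fixed set. *)

Require Import Defs.
From mathcomp Require Import perm ring lra.

Set Implicit Arguments.
Unset Strict Implicit.
Unset Printing Implicit Defensive.

Import Order.TTheory GRing.Theory Num.Theory.

Local Open Scope classical_set_scope.
Local Open Scope ring_scope.

(** * Functions of class C^k *)

(** The image of [rho] plays the part of a chamber, and [W] is the union of its translates by [H].
    Only a wall of codimension one could stop [W] from spreading, and such a wall belongs to a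
    reflection, hence to an element of [H]. The obstacle is that the isotropy group of a point x of
    [W] may contain elements outside [H], so that [saturation_near] says nothing at x itself.
    Therefore [W] is first spread over the nearby points with trivial isotropy, which are dense,
    along segments whose isotropy stays in [H]; closedness of [W] then fills in the remaining
    points, x included. Fixed subspaces of elements of [H] may be crossed freely: only the others
    have to be avoided. The analysis serves to pass between two languages. The argument speaks of
    ranks of matrices [A - 1], whereas [reflection] asks for smooth charts adapted to a whole
    component. That the averaged map is again a chart rests on the inverse function theorem, and
    that the rank belongs to g and the point alone rests on the chain rule. *)

Section RealCk.
Variables (R : realType) (m : nat).
Implicit Types (U V : set 'rV[R]_m) (f g : 'rV[R]_m -> R) (x v : 'rV[R]_m).

(** Scalar counterpart of [class_C]: real values admit products and inverses, and [class_C_coord]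
    carries the results back to vector-valued maps coordinate by coordinate. *)
Fixpoint Ck (k : nat) U f : Prop :=
  (forall x, U x -> {for x, continuous f}) /\
  if k is k'.+1 then
    forall i, (forall x, U x -> derivable f x 'e_i) /\ Ck k' U ('D_('e_i) f)
  else True.

Definition Cinf U f := forall k, Ck k U f.

Lemma Ck_continuous k U f : Ck k U f -> forall x, U x -> {for x, continuous f}.
Proof. by case: k => [|k] []. Qed.

Lemma Ck_derivable k U f i : Ck k.+1 U f ->
  forall x, U x -> derivable f x 'e_i.
Proof. by move=> [_ /(_ i)[]]. Qed.

Lemma Ck_derive k U f i : Ck k.+1 U f -> Ck k U ('D_('e_i) f).
Proof. by move=> [_ /(_ i)[]]. Qed.

Lemma CkW k U f : Ck k.+1 U f -> Ck k U f.
Proof.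
elim: k f => [|k IH] f; first by case.
by case=> cf df; split=> // i; have [d1 d2] := df i; split=> //; exact: IH.
Qed.

Lemma Ck_sub k U V f : V `<=` U -> Ck k U f -> Ck k V f.
Proof.
move=> VU; elim: k f => [|k IH] f [cf df]; split=> //.
- by move=> x /VU; exact: cf.
- by move=> x /VU; exact: cf.
move=> i; have [d1 d2] := df i; split; last exact: IH.
by move=> x /VU; exact: d1.
Qed.

Lemma Ck_local k U f :
  (forall x, U x -> exists2 V, V x & Ck k V f) -> Ck k U f.
Proof.
elim: k f => [|k IH] f H; split=> //.
- by move=> x /H[V Vx [cf _]]; exact: cf.
- by move=> x /H[V Vx [cf _]]; exact: cf.
move=> i; split; first by move=> x /H[V Vx fV]; exact: Ck_derivable fV _ Vx.
by apply: IH => x /H[V Vx fV]; exists V => //; exact: Ck_derive.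
Qed.

Lemma open_near_eq (T : Type) U (f g : 'rV[R]_m -> T) x : open U ->
  (forall y, U y -> f y = g y) -> U x -> \near x, f x = g x.
Proof.
by move=> oU fg Ux; near do apply: fg; exact: open_nbhs_nbhs.
Unshelve. all: by end_near. Qed.

Lemma continuous_at_eq (T S : topologicalType) (f g : T -> S) (x : T) :
  (\near x, f x = g x) -> {for x, continuous f} -> {for x, continuous g}.
Proof.
move=> fg cf; rewrite /prop_for /continuous_at -(nbhs_singleton fg).
by apply: cvg_trans cf; exact: near_eq_cvg.
Qed.

Lemma Ck_eq k U f g : open U -> (forall y, U y -> f y = g y) ->
  Ck k U f -> Ck k U g.
Proof.
move=> oU; elim: k f g => [|k IH] f g fg [cf df]; split=> //.
- by move=> x Ux; apply: continuous_at_eq (cf x Ux); exact: open_near_eq oU fg Ux.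
- by move=> x Ux; apply: continuous_at_eq (cf x Ux); exact: open_near_eq oU fg Ux.
move=> i; have [d1 d2] := df i; split.
  move=> x Ux; apply: near_eq_derivable (d1 x Ux); exact: open_near_eq oU fg Ux.
apply: IH d2 => y Uy; apply: near_eq_derive; exact: open_near_eq oU fg Uy.
Qed.

Lemma Ck_cst k U (c : R) : Ck k U (fun=> c).
Proof.
elim: k c => [|k IH] c; split=> //; [by move=> *; exact: cst_continuous..|].
move=> i; split=> [x _|]; first exact: derivable_cst.
have -> : 'D_('e_i) (fun=> c) = (fun=> 0) :> ('rV[R]_m -> R).
  by apply/funext => x; rewrite derive_cst.
exact: IH.
Qed.

Lemma derive_coord (i j : 'I_m) x :
  is_derive x 'e_i (fun y : 'rV[R]_m => y 0 j) ((i == j)%:R).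
Proof.
have d : differentiable (fun N : 'rV[R]_m => N 0 j : R) x.
  exact: differentiable_coord.
have dd : derivable (@id 'rV[R]_m) x 'e_i by exact: derivable_id.
split; first exact: diff_derivable.
have := derive_mx dd; rewrite derive_id => /matrixP/(_ 0 j).
by rewrite !mxE eqxx /= eq_sym => <-.
Qed.

Lemma Ck_coord k U j : Ck k U (fun x => x 0 j).
Proof.
case: k => [|k]; split=> //; [by move=> *; exact: coord_continuous..|].
move=> i; split=> [x _|]; first by case: (derive_coord i j x).
have -> : 'D_('e_i) (fun x => x 0 j) = (fun=> (i == j)%:R) :> ('rV[R]_m -> R).
  by apply/funext => x; case: (derive_coord i j x).
exact: Ck_cst.
Qed.

Lemma Ck_add k U f g : open U -> Ck k U f -> Ck k U g ->
  Ck k U (fun x => f x + g x).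
Proof.
move=> oU; elim: k f g => [|k IH] f g [cf df] [cg dg]; split=> //.
- by move=> x Ux; apply: continuousD; [exact: cf|exact: cg].
- by move=> x Ux; apply: continuousD; [exact: cf|exact: cg].
move=> i; have [d1 d2] := df i; have [e1 e2] := dg i; split.
  by move=> x Ux; apply: derivableD; [exact: d1|exact: e1].
apply: Ck_eq (IH _ _ d2 e2) => // y Uy.
by rewrite deriveD //; [exact: d1|exact: e1].
Qed.

Lemma Ck_mul k U f g : open U -> Ck k U f -> Ck k U g ->
  Ck k U (fun x => f x * g x).
Proof.
move=> oU; elim: k f g => [|k IH] f g sf sg; split=> //.
- move=> x Ux; apply: continuousM; [exact: Ck_continuous sf _ Ux|exact: Ck_continuous sg _ Ux].
- move=> x Ux; apply: continuousM; [exact: Ck_continuous sf _ Ux|exact: Ck_continuous sg _ Ux].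
have [[cf df] [cg dg]] := (sf, sg).
move=> i; have [d1 d2] := df i; have [e1 e2] := dg i; split.
  by move=> x Ux; apply: derivableM; [exact: d1|exact: e1].
(* Leibniz' rule keeps one factor undifferentiated, so that factor must be lowered by one class
   before the induction hypothesis applies. *)
have H := Ck_add oU (IH _ _ (CkW sf) e2) (IH _ _ (CkW sg) d2).
apply: Ck_eq H => // y Uy.
by rewrite deriveM //; [exact: d1|exact: e1].
Qed.

Lemma Ck_opp k U f : open U -> Ck k U f -> Ck k U (fun x => - f x).
Proof.
move=> oU sf; have := Ck_mul oU (Ck_cst k U (-1)) sf.
by apply: Ck_eq => // y _; rewrite mulN1r.
Qed.

Lemma Ck_sum k U I (r : seq I) (P : pred I) (F : I -> 'rV[R]_m -> R) : open U ->
  (forall i, P i -> Ck k U (F i)) -> Ck k U (fun x => \sum_(i <- r | P i) F i x).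
Proof.
move=> oU HF; elim: r => [|i r IH].
  by apply: Ck_eq (Ck_cst k U 0) => // y _; rewrite big_nil.
case Pi : (P i); last by apply: Ck_eq IH => // y _; rewrite big_cons Pi.
apply: Ck_eq (Ck_add oU (HF i Pi) IH) => // y _; by rewrite big_cons Pi.
Qed.

Lemma Ck_prod k U I (r : seq I) (P : pred I) (F : I -> 'rV[R]_m -> R) : open U ->
  (forall i, P i -> Ck k U (F i)) -> Ck k U (fun x => \prod_(i <- r | P i) F i x).
Proof.
move=> oU HF; elim: r => [|i r IH].
  by apply: Ck_eq (Ck_cst k U 1) => // y _; rewrite big_nil.
case Pi : (P i); last by apply: Ck_eq IH => // y _; rewrite big_cons Pi.
apply: Ck_eq (Ck_mul oU (HF i Pi) IH) => // y _; by rewrite big_cons Pi.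
Qed.

(** The derivative of 1/f is -(1/f)(1/f)f', in which 1/f recurs one class lower; induction on [k]
    closes the loop. *)
Lemma Ck_inv k U f : open U -> (forall x, U x -> f x != 0) -> Ck k U f ->
  Ck k U (fun x => (f x)^-1).
Proof.
move=> oU f0; elim: k f f0 => [|k IH] f f0 sf; split=> //.
- by move=> x Ux; apply: continuousV; [exact: f0|exact: Ck_continuous sf _ Ux].
- by move=> x Ux; apply: continuousV; [exact: f0|exact: Ck_continuous sf _ Ux].
move=> i; have [d1 d2] := sf.2 i; split.
  by move=> x Ux; apply: derivableV; [exact: f0|exact: d1].
have fV := IH _ f0 (CkW sf).
have H := Ck_opp oU (Ck_mul oU (Ck_mul oU fV fV) d2).
apply: Ck_eq H => // y Uy.
rewrite deriveV ?f0//; last exact: d1.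
by rewrite /GRing.scale /= expr2 invfM mulNr.
Qed.

End RealCk.

Lemma class_C_coord (R : realType) (m n k : nat) (U : set 'rV[R]_m)
    (f : 'rV[R]_m -> 'rV[R]_n) : open U ->
  class_C k U f <-> forall j, Ck k U (fun x => f x 0 j).
Proof.
move=> oU.
have cont (g : 'rV[R]_m -> 'rV[R]_n) : {in U, continuous g} <->
    forall j x, U x -> {for x, continuous (fun x => g x 0 j)}.
  split=> [cg j x /mem_set Ux|cg x /set_mem Ux].
    apply: (@continuous_comp _ _ _ g (fun y : 'rV[R]_n => y 0 j) x).
      exact: (cg x Ux).
    by move=> A; exact: coord_continuous.
  (* A neighbourhood of a matrix contains a product [P] of neighbourhoods of its finitely many
     entries. *)
  move=> A [P HP sPA].
  have : \forall y \near x, forall ij : 'I_1 * 'I_n, P ij.1 ij.2 (g y ij.1 ij.2).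
    apply: (@filter_forall _ _ _ (nbhs x)) => -[i j] /=.
    by rewrite (ord1 i); exact: (cg j x Ux _ (HP 0 j)).
  move=> H; apply: (@filterS _ (nbhs x) _ _ _ _ H) => y Hy.
  by apply: sPA => i j; exact: (Hy (i, j)).
elim: k f => [|k IH] f.
  split=> [[/cont cf _] j|H]; first by split=> // x; exact: cf.
  by split=> //; apply/cont => j x; exact: (H j).1.
split=> [[/cont cf df] j|H].
  split=> [x Ux|i]; first exact: cf.
  have [d1 /IH d2] := df i; split.
    by move=> x Ux; have /derivable_mxP := d1 _ (mem_set Ux) ; apply.
  apply: Ck_eq (d2 j) => // y Uy; rewrite derive_mx ?mxE //.
  by apply: d1; exact: mem_set.
split; first by apply/cont => j x; exact: (H j).1.
move=> i.
have d1 x : U x -> derivable f x 'e_i.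
  move=> Ux; apply/derivable_mxP => a j; rewrite (ord1 a).
  exact: Ck_derivable (H j) _ Ux.
split; first by move=> x /set_mem; exact: d1.
apply/IH => j; apply: Ck_eq (Ck_derive i (H j)) => // y Uy.
by rewrite derive_mx ?mxE //; exact: d1.
Qed.

(** The norm is a maximum of entries with default value 0, whence [0 <= r], which matters when
    [n = 0]. *)
Lemma rV_norm_le (R : realType) (n : nat) (v : 'rV[R]_n) (r : R) : 0 <= r ->
  `|v| <= r <-> forall j, `|v 0 j| <= r.
Proof.
move=> r0; rewrite {1}/Num.Def.normr /= mx_normrE; split=> [H j|H].
  by apply: le_trans H; apply/bigmax_geP; right; exists (0, j).
by apply/bigmax_leP; split=> // -[i j] _; rewrite /= (ord1 i).
Qed.

Lemma rV_coord_le (R : realType) (n : nat) (v : 'rV[R]_n) j : `|v 0 j| <= `|v|.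
Proof. exact: (iffLR (rV_norm_le v (normr_ge0 v)) (lexx _) j). Qed.

(** * Mean values and first-order expansions *)

Section Differentiable.
Variables (R : realType) (m : nat).
Implicit Types (U : set 'rV[R]_m) (x v a : 'rV[R]_m).

Lemma is_derive_line (f : 'rV[R]_m -> R) a v (t : R) d :
  is_derive (a + t *: v) v f d ->
  is_derive (t : R^o) (1 : R^o) (fun s : R^o => f (a + s *: v) : R^o) d.
Proof.
have E : (fun h : R => h^-1 *: ((f \o shift (a + t *: v)) (h *: v) - f (a + t *: v)))
  = (fun h : R => h^-1 *: (((fun s : R => f (a + s *: v)) \o shift t) (h *: 1)
      - f (a + t *: v))) :> (R -> R).
  apply/funext => h /=; congr (_ *: (f _ - _)).
  by rewrite addrCA [h *: 1]mulr1 -scalerDl.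
move=> [d1 d2]; split; first by rewrite /derivable -E.
by rewrite -d2 /derive E.
Qed.

(** The one-variable mean value theorem between 0 and [s]; a bound on absolute values treats both
    signs of [s] at once. *)
Lemma mean_value_line (f : 'rV[R]_m -> R) a v (s : R) :
  (forall c : R, `|c| <= `|s| -> derivable f (a + c *: v) v) ->
  exists2 c : R, `|c| <= `|s| & f (a + s *: v) - f a = s * 'D_v f (a + c *: v).
Proof.
move=> df.
have dl c : `|c| <= `|s| ->
   is_derive (c : R^o) (1 : R^o) (fun s : R^o => f (a + s *: v) : R^o) ('D_v f (a + c *: v)).
  by move=> cs; apply: is_derive_line; apply: derivableP; exact: df.
have cl (b c : R) : (forall t : R, b <= t <= c -> `|t| <= `|s|) ->
    {within `[b, c], continuous (fun s : R => f (a + s *: v))}.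
  move=> H; apply: derivable_within_continuous => t; rewrite in_itv /= => /H/dl.
  by case.
have [s0|s0] := lerP 0 s.
  have bd t : 0 <= t <= s -> `|t| <= `|s|.
    by move=> /andP[t0 ts]; rewrite !ger0_norm.
  have [t||c] := @MVT_segment _ (fun s : R => f (a + s *: v))
    (fun t => 'D_v f (a + t *: v)) 0 s s0.
  - by rewrite in_itv/= => /andP[/ltW t0 /ltW ts]; apply/dl/bd/andP.
  - exact: cl.
  rewrite in_itv /= => /bd cs; rewrite scale0r addr0 subr0 mulrC => E.
  by exists c.
have bd t : s <= t <= 0 -> `|t| <= `|s|.
  move=> /andP[st t0]; rewrite !ler0_norm ?lerN2 //; lra.
have [t||c] := @MVT_segment _ (fun s : R => f (a + s *: v))
  (fun t => 'D_v f (a + t *: v)) s 0 (ltW s0).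
- by rewrite in_itv/= => /andP[/ltW t0 /ltW ts]; apply/dl/bd/andP.
- exact: cl.
rewrite in_itv /= => /bd cs; rewrite scale0r addr0 sub0r mulrN => E.
by exists c => //; rewrite mulrC -opprB E opprK.
Qed.

(** The points [x + trunc k h] form a staircase from [x] to [x + h] that changes one coordinate at a
    time, so that only partial derivatives enter. *)
Definition trunc (k : nat) v : 'rV[R]_m :=
  \row_j (if (j < k)%N then v 0 j else 0).

Lemma C1_expand U (f : 'rV[R]_m -> R) x : open U -> Ck 1 U f -> U x ->
  forall e, 0 < e -> \forall h \near (0 : 'rV[R]_m),
    `|f (x + h) - f x - \sum_j h 0 j * 'D_('e_j) f x| <= e * `|h|.
Proof.
move=> oU sf Ux e e0.
(* Each of the [m] stairs contributes an error of at most [e'] times the norm of [h]; the successor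
   keeps the division meaningful when [m = 0]. *)
pose e' := e / m.+1%:R; have e'0 : 0 < e' by rewrite divr_gt0.
have N : \forall y \near x, U y /\ forall j : 'I_m, `|'D_('e_j) f x - 'D_('e_j) f y| <= e'.
  apply: filterI; first exact: open_nbhs_nbhs.
  apply: (@filter_forall _ _ _ (nbhs x)) => j.
  have /cvgrPdist_le/(_ e' e'0) := Ck_continuous (Ck_derive j sf) Ux.
  exact.
move/nbhs_ballP: N => [d /= d0 N].
have {}N h : `|h| < d -> U (x + h) /\
    forall j : 'I_m, `|'D_('e_j) f x - 'D_('e_j) f (x + h)| <= e'.
  by move=> hd; apply: N; rewrite -ball_normE /= opprD addNKr normrN.
near=> h.
have hd : `|h| < d.
  by near: h; apply/nbhs_ballP; exists d => //= y; rewrite -ball_normE /= sub0r normrN.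
have claim k : (k <= m)%N -> `|f (x + trunc k h) - f x -
    \sum_(j < m | (j < k)%N) h 0 j * 'D_('e_j) f x| <= (k%:R * e') * `|h|.
  elim: k => [_|k IH km].
    have -> : trunc 0 h = 0 by apply/rowP => j; rewrite !mxE.
    by rewrite addr0 subrr big_pred0 // subr0 normr0 !mul0r.
  pose jk := Ordinal km; pose w := x + trunc k h.
  have tr : x + trunc k.+1 h = w + h 0 jk *: 'e_jk.
    rewrite /w -addrA; congr (_ + _); apply/rowP => j; rewrite !mxE eqxx /=.
    have [-> /=|jj] := eqVneq j jk; first by rewrite ltnS leqnn ltnn add0r mulr1.
    rewrite mulr0 addr0 ltnS leq_eqVlt; case: eqP => //= jk'.
    by move: jj => /eqP[]; exact/val_inj.
  (* In the maximum norm, a partly truncated [h] is no longer than [h], so every intermediate point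
     stays in the ball of radius [d]. *)
  have small c : `|c| <= `|h 0 jk| -> `|trunc k h + c *: 'e_jk| < d.
    move=> ch; apply: le_lt_trans hd; apply/rV_norm_le => // j.
    rewrite !mxE eqxx /=; have [-> /=|jj] := eqVneq j jk.
      by rewrite ltnn add0r mulr1; exact: le_trans ch (rV_coord_le _ _).
    by rewrite mulr0 addr0; case: ifP => _; rewrite ?normr0 // rV_coord_le.
  have [|c ch E] := @mean_value_line f w 'e_jk (h 0 jk).
    move=> c /small/N[+ _]; rewrite addrA => UU; by apply: Ck_derivable sf _ UU.
  rewrite tr (bigD1 jk) /= ?ltnSn //.
  rewrite (eq_bigl (fun j : 'I_m => (j < k)%N)); last first.
    move=> j; rewrite ltnS ltn_neqAle andbC; congr (_ && _).
  have IH' := IH (ltnW km); rewrite -/w in IH'.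
  set S := \sum_(j < m | _) _ in IH' *.
  have -> : f (w + h 0 jk *: 'e_jk) - f x - (h 0 jk * 'D_('e_jk) f x + S) =
     (f w - f x - S) - h 0 jk * ('D_('e_jk) f x - 'D_('e_jk) f (w + c *: 'e_jk)).
    by rewrite -[f (w + _)](subrK (f w)) E; ring.
  apply: le_trans (ler_normB _ _) _.
  have -> : k.+1%:R * e' * `|h| = k%:R * e' * `|h| + `|h| * e'.
    by rewrite -natr1; ring.
  apply: lerD IH' _; rewrite normrM; apply: ler_pM => //; first exact: rV_coord_le.
  have /small/N[_ /(_ jk)] := ch; by rewrite addrA.
have /claim := leqnn m.
have -> : trunc m h = h by apply/rowP => j; rewrite !mxE ltn_ord.
move=> H; rewrite (eq_bigl xpredT) in H; last by move=> j; rewrite ltn_ord.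
apply: le_trans H _; rewrite ler_wpM2r // /e'.
have q : m%:R / m.+1%:R <= 1 :> R by rewrite ler_pdivrMr // mul1r ler_nat.
by rewrite mulrCA ler_piMr // ltW.
Unshelve. all: by end_near. Qed.

(** The candidate differential is right multiplication by the matrix of partial derivatives;
    [C1_expand] controls each coordinate and the maximum norm combines them. *)
Lemma class_C1_differentiable n U (f : 'rV[R]_m -> 'rV[R]_n) x : open U ->
  class_C 1 U f -> U x -> differentiable f x.
Proof.
move=> oU /(class_C_coord _ _ oU) sf Ux.
pose J : 'M[R]_(m, n) := \matrix_(i, j) 'D_('e_i) (fun y => f y 0 j) x.
have cJ : continuous (mulmxr J : 'rV[R]_m -> 'rV[R]_n).
  move=> y; apply: differentiable_continuous.
  suff : differentiable (\sum_(i < m) (fun z : 'rV[R]_m => z 0 i *: row i J)) y.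
    congr (differentiable _ y); apply/funext => z /=; rewrite mulmx_sum_row.
    by rewrite fct_sumE.
  apply: differentiable_sum => i; apply: differentiableZl.
  exact: differentiable_coord.
have fE : f \o shift x = cst (f x) + mulmxr J +o_ (0 : 'rV[R]_m) id.
  apply/eqaddoP => e e0.
  have : \forall h \near (0 : 'rV[R]_m), forall j : 'I_n,
     `|f (x + h) 0 j - f x 0 j - \sum_i h 0 i * 'D_('e_i) (fun y => f y 0 j) x| <= e * `|h|.
    apply: (@filter_forall _ _ _ (nbhs (0 : 'rV[R]_m))) => j.
    exact: (C1_expand oU (sf j) Ux e0).
  apply: filterS => h H /=; apply/rV_norm_le; first by rewrite mulr_ge0 // ltW.
  move=> j; suff : `|(f (h + x) - (f x + h *m J)) 0 j| <= e * `|h| by [].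
  move: (H j); rewrite [x + h]addrC !mxE opprD addrA.
  by under [in X in _ -> X]eq_bigr do rewrite mxE.
have dE := diff_unique cJ fE.
by apply/diff_locallyP; rewrite dE.
Qed.

End Differentiable.

(** * Chain rule, smooth maps and Jacobians *)

Section Composition.
Variable R : realType.

Lemma C1_differentiable m U (f : 'rV[R]_m -> R) x : open U ->
  Ck 1 U f -> U x -> differentiable f x.
Proof.
move=> oU sf Ux; pose F (y : 'rV[R]_m) : 'rV[R]_1 := \row_j f y.
have -> : f = (fun N : 'rV[R]_1 => N 0 0) \o F.
  by apply/funext => y /=; rewrite mxE.
apply: differentiable_comp; last exact: differentiable_coord.
apply: (class_C1_differentiable oU _ Ux); apply/class_C_coord => // j.
by apply: Ck_eq sf => // y _; rewrite mxE.
Qed.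

Lemma derive_comp m n (f : 'rV[R]_n -> R) (g : 'rV[R]_m -> 'rV[R]_n) x v :
  differentiable g x -> differentiable f (g x) ->
  derivable (f \o g) x v /\ 'D_v (f \o g) x =
    \sum_j 'D_v (fun y => g y 0 j) x * 'D_('e_j) f (g x).
Proof.
move=> dg df; have dc : differentiable (f \o g) x by exact: differentiable_comp.
split; first exact: diff_derivable.
rewrite deriveE // diff_comp //=.
have -> : 'd g x v = 'D_v g x by rewrite deriveE.
rewrite [X in 'd f _ X]row_sum_delta linear_sum; apply: eq_bigr => j _.
rewrite linearZ /= -deriveE //; congr (_ * _).
by rewrite derive_mx ?mxE //; exact: diff_derivable.
Qed.

Lemma class_C_le m n k U (f : 'rV[R]_m -> 'rV[R]_n) : open U ->
  class_C k.+1 U f -> class_C k U f.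
Proof.
by move=> oU /(class_C_coord _ _ oU) H; apply/class_C_coord => // j; exact: CkW.
Qed.

Lemma class_C1 m n k U (f : 'rV[R]_m -> 'rV[R]_n) : open U ->
  class_C k.+1 U f -> class_C 1 U f.
Proof. by move=> oU; elim: k => // k IH /(class_C_le oU). Qed.

Lemma Ck1 m k U (f : 'rV[R]_m -> R) : Ck k.+1 U f -> Ck 1 U f.
Proof. by elim: k => // k IH /CkW. Qed.

(** By the chain rule a partial derivative of the composite is a sum of products of partials of [g]
    with partials of [f] composed with [g]; the latter are covered by the induction hypothesis,
    which ranges over all outer functions. *)
Lemma Ck_comp m n k (U : set 'rV[R]_m) (W : set 'rV[R]_n) f (g : 'rV[R]_m -> 'rV[R]_n) :
  open U -> open W -> (forall x, U x -> W (g x)) -> class_C k U g -> Ck k W f ->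
  Ck k U (f \o g).
Proof.
move=> oU oW gUW; elim: k f => [|k IH] f sg sf.
  split=> // x Ux; apply: continuous_comp; first exact: (sg.1 x (mem_set Ux)).
  exact: sf.1 _ (gUW _ Ux).
have dg x : U x -> differentiable g x.
  exact: class_C1_differentiable (class_C1 oU sg).
have df y : W y -> differentiable f y.
  exact: C1_differentiable (Ck1 sf).
split=> [x Ux|i].
  apply: continuous_comp; first exact: (sg.1 x (mem_set Ux)).
  exact: sf.1 _ (gUW _ Ux).
split=> [x Ux|].
  by have [] := derive_comp 'e_i (dg _ Ux) (df _ (gUW _ Ux)).
have H : Ck k U (fun x => \sum_j 'D_('e_i) (fun y => g y 0 j) x * 'D_('e_j) f (g x)).
  apply: Ck_sum => // j _; apply: Ck_mul => //.
    exact: (Ck_derive i (iffLR (class_C_coord _ _ oU) sg j)).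
  exact: (IH _ (class_C_le oU sg) (Ck_derive j sf)).
apply: Ck_eq H => // y Uy.
by have [_ ->] := derive_comp 'e_i (dg _ Uy) (df _ (gUW _ Uy)).
Qed.

Lemma smooth_on_coord m n U (f : 'rV[R]_m -> 'rV[R]_n) : open U ->
  smooth_on U f <-> forall j, Cinf U (fun x => f x 0 j).
Proof.
move=> oU; split=> [sf j k|sf k]; first exact: (iffLR (class_C_coord _ _ oU) (sf k)).
by apply/class_C_coord => // j; exact: sf.
Qed.

Lemma smooth_on_differentiable m n U (f : 'rV[R]_m -> 'rV[R]_n) x : open U ->
  smooth_on U f -> U x -> differentiable f x.
Proof. by move=> oU sf; apply: class_C1_differentiable oU (sf 1%N). Qed.

Lemma smooth_on_comp m n p U W (g : 'rV[R]_m -> 'rV[R]_n) (f : 'rV[R]_n -> 'rV[R]_p) :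
  open U -> open W -> (forall x, U x -> W (g x)) ->
  smooth_on U g -> smooth_on W f -> smooth_on U (f \o g).
Proof.
move=> oU oW gUW sg /(smooth_on_coord _ oW) sf; apply/smooth_on_coord => // j k.
exact: (Ck_comp oU oW gUW (sg k) (sf j k)).
Qed.

Lemma smooth_on_eq m n U (f g : 'rV[R]_m -> 'rV[R]_n) : open U ->
  (forall y, U y -> f y = g y) -> smooth_on U f -> smooth_on U g.
Proof.
move=> oU fg /(smooth_on_coord _ oU) sf; apply/smooth_on_coord => // j k.
by apply: Ck_eq (sf j k) => // y Uy; rewrite fg.
Qed.

Lemma smooth_on_sub m n U V (f : 'rV[R]_m -> 'rV[R]_n) : open U -> open V ->
  V `<=` U -> smooth_on U f -> smooth_on V f.
Proof.
move=> oU oV VU /(smooth_on_coord _ oU) sf; apply/smooth_on_coord => // j k.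
exact: Ck_sub (sf j k).
Qed.

Lemma smooth_on_local m n U (f : 'rV[R]_m -> 'rV[R]_n) : open U ->
  (forall x, U x -> exists V, [/\ open V, V x & smooth_on V f]) -> smooth_on U f.
Proof.
move=> oU H; apply/smooth_on_coord => // j k; apply: Ck_local => x /H[V [oV Vx sf]].
by exists V => //; exact: (iffLR (smooth_on_coord _ oV) sf).
Qed.

Lemma smooth_on_id m U : open U -> smooth_on U (@id 'rV[R]_m).
Proof. by move=> oU; apply/smooth_on_coord => // j k; exact: Ck_coord. Qed.

Lemma smooth_on_cst m n U (b : 'rV[R]_n) : open U -> smooth_on U (fun _ : 'rV[R]_m => b).
Proof. by move=> oU; apply/smooth_on_coord => // j k; exact: Ck_cst. Qed.

Lemma smooth_on_add m n U (f g : 'rV[R]_m -> 'rV[R]_n) : open U ->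
  smooth_on U f -> smooth_on U g -> smooth_on U (fun x => f x + g x).
Proof.
move=> oU /(smooth_on_coord _ oU) sf /(smooth_on_coord _ oU) sg.
apply/smooth_on_coord => // j k.
by apply: Ck_eq (Ck_add oU (sf j k) (sg j k)) => // y _; rewrite mxE.
Qed.

Lemma smooth_on_sum m n U I (r : seq I) (F : I -> 'rV[R]_m -> 'rV[R]_n) : open U ->
  (forall i, smooth_on U (F i)) -> smooth_on U (fun x => \sum_(i <- r) F i x).
Proof.
move=> oU sF; elim: r => [|i r IH].
  by apply: smooth_on_eq (smooth_on_cst 0 oU) => // y _; rewrite big_nil.
by apply: smooth_on_eq (smooth_on_add oU (sF i) IH) => // y _; rewrite big_cons.
Qed.

Lemma smooth_on_mulmx m n p U (f : 'rV[R]_m -> 'rV[R]_n) (A : 'M[R]_(n, p)) : open U ->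
  smooth_on U f -> smooth_on U (fun x => f x *m A).
Proof.
move=> oU /(smooth_on_coord _ oU) sf; apply/smooth_on_coord => // j k.
have H : Ck k U (fun x => \sum_i f x 0 i * A i j).
  by apply: Ck_sum => // i _; apply: Ck_mul => //; [exact: sf|exact: Ck_cst].
by apply: Ck_eq H => // y _; rewrite mxE.
Qed.

Lemma smooth_on_continuous m n U (f : 'rV[R]_m -> 'rV[R]_n) x :
  smooth_on U f -> U x -> {for x, continuous f}.
Proof. by move=> sf Ux; have [+ _] := sf 0%N; apply; exact: mem_set. Qed.

Lemma jacobianE m n (f : 'rV[R]_m -> 'rV[R]_n) x i j : differentiable f x ->
  ('J f x) i j = 'D_('e_i) (fun y => f y 0 j) x.
Proof.
move=> df; have := derive_mx (diff_derivable (v := 'e_i) df).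
rewrite deriveEjacobian // -rowE => /matrixP/(_ 0 j); by rewrite !mxE.
Qed.

Lemma diff_jacobian m n (f : 'rV[R]_m -> 'rV[R]_n) x v : differentiable f x ->
  'd f x v = v *m 'J f x.
Proof. by move=> df; rewrite -deriveE // deriveEjacobian. Qed.

Lemma jacobian_comp m n p (f : 'rV[R]_n -> 'rV[R]_p) (g : 'rV[R]_m -> 'rV[R]_n) x :
  differentiable g x -> differentiable f (g x) ->
  'J (f \o g) x = 'J g x *m 'J f (g x).
Proof.
move=> dg df; have dc : differentiable (f \o g) x by exact: differentiable_comp.
apply/row_matrixP => i; rewrite !rowE -diff_jacobian // diff_comp //= diff_jacobian //.
by rewrite diff_jacobian // mulmxA.
Qed.

(** Both maps have the same first-order expansion at [x], and the differential is unique. This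
    transfers identities known only near a point to Jacobians. *)
Lemma jacobian_eq m n (f g : 'rV[R]_m -> 'rV[R]_n) x :
  (\near x, f x = g x) -> differentiable f x ->
  differentiable g x /\ 'J g x = 'J f x.
Proof.
move=> fg /diff_locallyP[cf ef].
have dg : g \o shift x = cst (g x) + 'd f x +o_ (0 : 'rV[R]_m) id.
  apply/eqaddoP => e e0; have /eqaddoP/(_ e e0) := ef.
  apply: filter_app; near=> h.
  suff E : (f \o shift x) h = (g \o shift x) h.
    move=> H; have {}H : `|(f \o shift x) h - (f x + 'd f x h)| <= e * `|h| by [].
    by rewrite E (nbhs_singleton fg) in H.
  rewrite /=; near: h.
  have := fg; rewrite (near_shift 0) /=; apply: filterS => h.
  by rewrite subr0.
have E := diff_unique cf dg.
have dgx : differentiable g x.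
  by apply/diff_locallyP; rewrite E; exact: (conj cf dg).
have dfx : differentiable f x by apply/diff_locallyP; exact: (conj cf ef).
split; first exact: dgx.
apply/row_matrixP => i.
have e1 := diff_jacobian 'e_i dgx.
rewrite E in e1.
rewrite (diff_jacobian 'e_i dfx) in e1.
move: e1; generalize ('J f x); generalize ('J g x) => A B e1.
by rewrite !rowE e1.
Unshelve. all: by end_near. Qed.

Lemma jacobian_mulmx m n (A : 'M[R]_(m, n)) (b : 'rV[R]_n) x :
  differentiable (fun v => v *m A + b) x /\ 'J (fun v => v *m A + b) x = A.
Proof.
have oT : open [set: 'rV[R]_m] by exact: openT.
have sA : smooth_on [set: 'rV[R]_m] (fun v => v *m A + b).
  apply: smooth_on_add => //; last exact: smooth_on_cst.
  by apply: smooth_on_mulmx => //; exact: smooth_on_id.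
have dA : differentiable (fun v => v *m A + b) x.
  exact: smooth_on_differentiable oT sA I.
split=> //; apply/matrixP => i j; rewrite jacobianE //.
have -> : (fun v : 'rV[R]_m => (v *m A + b) 0 j) =
    (\sum_(k < m) (fun v : 'rV[R]_m => v 0 k * A k j)) + cst (b 0 j).
  by apply/funext => v; rewrite !mxE fct_sumE.
have d k : is_derive x 'e_i (fun v : 'rV[R]_m => v 0 k * A k j) ((i == k)%:R * A k j).
  have dk := derive_coord i k x; have dc := is_derive_cst (A k j) x 'e_i.
  have [h1 h2] := is_deriveM dk dc; split; first exact: h1.
  by apply: etrans h2 _; rewrite scaler0 add0r /GRing.scale /= mulrC.
have ds := is_derive_sum d.
have [_ ->] := is_deriveD ds (is_derive_cst (b 0 j) x 'e_i).
rewrite addr0 (bigD1 i) //= eqxx mul1r big1 ?addr0 // => k ki.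
by rewrite eq_sym (negbTE ki) mul0r.
Qed.

End Composition.

(** * Inverse function theorem *)

Section MatrixCk.
Variables (R : realType) (m k : nat) (U : set 'rV[R]_m).
Hypothesis oU : open U.

Lemma Ck_det n (M : 'rV[R]_m -> 'M[R]_n) :
  (forall i j, Ck k U (fun x => M x i j)) -> Ck k U (fun x => \det (M x)).
Proof.
move=> sM; apply: Ck_sum => // s _; apply: Ck_mul => //; first exact: Ck_cst.
by apply: Ck_prod => // i _; exact: sM.
Qed.

(** Cramer's formula: the entries of the inverse are cofactors divided by the determinant. *)
Lemma Ck_invmx n (M : 'rV[R]_m -> 'M[R]_n) i j :
  (forall x, U x -> M x \in unitmx) ->
  (forall i j, Ck k U (fun x => M x i j)) -> Ck k U (fun x => invmx (M x) i j).
Proof.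
move=> uM sM.
have H : Ck k U (fun x => (\det (M x))^-1 * cofactor (M x) j i).
  apply: Ck_mul => //.
    apply: Ck_inv => //; last exact: Ck_det.
    by move=> x /uM; rewrite unitmxE unitfE.
  apply: Ck_mul => //; first exact: Ck_cst.
  by apply: Ck_det => a b; apply: Ck_eq (sM (lift j a) (lift i b)) => // y _; rewrite !mxE.
by apply: Ck_eq H => // y Uy; rewrite /invmx uM // !mxE.
Qed.

End MatrixCk.

Section InverseFunction.
Variables (R : realType) (n : nat).
Variables (U : set 'rV[R]_n) (f : 'rV[R]_n -> 'rV[R]_n) (p : 'rV[R]_n).
Hypotheses (oU : open U) (Up : U p) (sf : smooth_on U f) (Jp : 'J f p = 1%:M).

Let df x : U x -> differentiable f x.
Proof. exact: smooth_on_differentiable oU sf. Qed.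

Let sJ i j : Cinf U (fun x => ('J f x) i j).
Proof.
move=> k; have H := Ck_derive i (iffLR (smooth_on_coord _ oU) sf j k.+1).
by apply: Ck_eq H => // y Uy; rewrite jacobianE //; exact: df.
Qed.

(** As the Jacobian at [p] is 1, the map f - id has small derivative near [p]; the constant 1/2 will
    make f expand distances by a factor of at least 1/2. *)
Lemma near_identity_lipschitz : exists2 r : R, 0 < r &
  forall u, `|u - p| < r -> [/\ U u, 'J f u \in unitmx &
    forall v, `|v - p| < r -> `|(f v - v) - (f u - u)| <= 2^-1 * `|v - u|].
Proof.
(* A coordinate of a vector times a matrix is a sum of [n] products, so entries of size [e] give a
   factor of at most 1/2. *)
pose e : R := 2^-1 / n.+1%:R; have e0 : 0 < e by rewrite divr_gt0.
have N : \forall x \near p, [/\ U x, 'J f x \in unitmx &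
    forall ij : 'I_n * 'I_n, `|('J f x - 1%:M) ij.1 ij.2| <= e].
  have N1 : \forall x \near p, U x by exact: open_nbhs_nbhs.
  have N2 : \forall x \near p, 'J f x \in unitmx.
    have cd : {for p, continuous (fun x => \det ('J f x))}.
      apply: (@Ck_continuous _ _ 0 U) => //; apply: Ck_det => // i j; exact: sJ.
    have : \det ('J f p) != 0 by rewrite Jp det1 oner_neq0.
    move=> /(cvgr_neq0 (\det ('J f p))) H; have H' := H _ (nbhs p) _ _ cd.
    by apply: (@filterS _ (nbhs p) _ _ _ _ (H' (nbhs_filter p))) => x /=; rewrite unitmxE unitfE.
  have N3 : \forall x \near p, forall ij : 'I_n * 'I_n, `|('J f x - 1%:M) ij.1 ij.2| <= e.
    apply: (@filter_forall _ _ _ (nbhs p)) => -[i j] /=.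
    have /cvgrPdist_le/(_ e e0) := Ck_continuous (sJ i j 0%N) Up.
    move=> H; apply: (@filterS _ (nbhs p) _ _ _ _ H) => x.
    by rewrite Jp !mxE distrC.
  by near=> x; split; near: x.
move/nbhs_ballP: N => [d /= d0 N].
have {}N x : `|x - p| < d -> [/\ U x, 'J f x \in unitmx &
    forall i j, `|('J f x - 1%:M) i j| <= e].
  move=> xd; have [|a b c] := N x; first by rewrite -ball_normE /= distrC.
  by split=> // i j; exact: c (i, j).
(* A point [u + c *: (v - u)] with [c] in [-1, 1] is at distance at most 2 |u - p| + |v - p| from
   [p]. *)
exists (d / 3); first by rewrite divr_gt0.
move=> u ud; have ud' : `|u - p| < d by lra.
have [Uu Ju _] := N _ ud'; split=> // v vd.
apply/rV_norm_le; first by rewrite mulr_ge0.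
move=> j; pose g (x : 'rV[R]_n) := (f x - x) 0 j.
have dg x : `|x - p| < d -> forall w, is_derive x w g ((w *m ('J f x - 1%:M)) 0 j).
  move=> /N[Ux _ _] w.
  have d1 : is_derive x w f (w *m 'J f x).
    by split; [exact: diff_derivable (df Ux)|rewrite deriveEjacobian //; exact: df].
  have [d2 d3] := is_deriveB d1 (is_derive_id x w).
  split; first by move/derivable_mxP: d2 => /(_ 0 j).
  have := derive_mx d2; rewrite d3 => /matrixP/(_ 0 j); rewrite [RHS]mxE => E.
  by rewrite -E mulmxBr mulmx1.
have seg (c : R) : `|c| <= `|1 : R| -> `|u + c *: (v - u) - p| < d.
  rewrite normr1 => c1; rewrite addrAC; apply: le_lt_trans (ler_normD _ _) _.
  rewrite normrZ; have : `|c| * `|v - u| <= `|v - u| by rewrite ler_piMl.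
  have : `|v - u| <= `|v - p| + `|u - p|.
    by rewrite -[v - u](subrKA p) -[in X in _ <= X](distrC p u) ler_normD.
  by lra.
have [c c1|c c1] := @mean_value_line _ _ g u (v - u) 1.
  by have [] := dg _ (seg c c1) (v - u).
rewrite scale1r subrKC mul1r => E.
have -> : (f v - v - (f u - u)) 0 j = g v - g u by rewrite [LHS]mxE [X in _ + X]mxE.
rewrite E; have [_ ->] := dg _ (seg c c1) (v - u).
rewrite mxE; apply: le_trans (ler_norm_sum _ _ _) _.
apply: (@le_trans _ _ (\sum_(i < n) `|v - u| * e)).
  apply: ler_sum => i _; rewrite normrM; apply: ler_pM => //; first exact: rV_coord_le.
  by have [_ _] := N _ (seg c c1); apply.
rewrite sumr_const card_ord -mulrnAr mulrC ler_wpM2r // /e.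
rewrite -mulr_natl mulrCA ler_piMr // ler_pdivrMr // mul1r ler_nat //.
Unshelve. all: by end_near. Qed.

(** The Lipschitz bound makes f injective with a 2-Lipschitz inverse. This turns the first-order
    expansion of f into one of [psi], and smoothness of [psi] follows by bootstrapping from the
    formula for its Jacobian. *)
Theorem inverse_function : exists V (psi : 'rV[R]_n -> 'rV[R]_n),
  [/\ open V, V p /\ V `<=` U, open (f @` V), {in V, cancel f psi} &
      smooth_on (f @` V) psi].
Proof.
have [r r0 lip] := near_identity_lipschitz.
have expand u v : `|u - p| < r -> `|v - p| < r -> `|v - u| <= 2 * `|f v - f u|.
  move=> ur vr; have [_ _ /(_ v vr) H] := lip _ ur.
  have : `|v - u| <= `|f v - f u| + `|(f v - v) - (f u - u)|.
    have -> : v - u = (f v - f u) - ((f v - v) - (f u - u)).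
      by apply/rowP => j; rewrite !mxE; ring.
    exact: ler_normB.
  by lra.
pose rho := r / 2; have rho0 : 0 < rho by rewrite divr_gt0.
have rhor : rho < r by rewrite /rho; lra.
(* With radius [rho / 2] the Newton step stays in the closed ball, since rho/2 + rho/2 = rho, and
   the solution satisfies |v0 - p| <= 2 |y - f p| < rho. *)
have surj y : `|y - f p| < rho / 2 -> exists2 v, `|v - p| < rho & f v = y.
  move=> yr; pose K := [set v : 'rV[R]_n | `|v - p| <= rho].
  have cN (w : 'rV[R]_n) : continuous (fun v : 'rV[R]_n => `|v - w|).
    move=> v; apply: (@continuous_comp _ _ _ (fun v : 'rV[R]_n => v - w) Num.norm).
      by apply: continuousB; [exact: id|exact: cst_continuous].
    exact: norm_continuous.
  have cK : compact K.
    apply: bounded_closed_compact.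
      exists (rho + `|p|); split; first exact: num_real.
      move=> M rM v /= vK; apply: le_trans (ltW rM).
      by rewrite -[v](subrK p); apply: le_trans (ler_normD _ _) _; rewrite lerD2r.
    by apply: closed_comp (@closed_le _ rho) => v _; exact: cN.
  have Kp : K p by rewrite /K /= subrr normr0 ltW.
  (* The Newton step w := v0 + (y - f v0) at a minimum v0 of |f v - y| halves
     this distance, which must therefore be zero. *)
  have [||v0 Kv0 min] := @EVT_min_rV _ _ (fun v => `|f v - y|) K _ cK.
  - by exists p.
  - apply: continuous_in_subspaceT => v /set_mem Kv.
    apply: (@continuous_comp _ _ _ f (fun w : 'rV[R]_n => `|w - y|)); last exact: cN.
    have [Uv _ _] := lip v (le_lt_trans Kv rhor).
    exact: smooth_on_continuous sf Uv.
  have v0r : `|v0 - p| < r by exact: le_lt_trans (set_mem Kv0) rhor.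
  have pr : `|p - p| < r by rewrite subrr normr0.
  have {Kv0}Kv0 : `|v0 - p| <= rho by exact: set_mem Kv0.
  have [_ _ /(_ _ v0r) Lp] := lip _ pr.
  pose w := v0 + (y - f v0).
  have Kw : `|w - p| <= rho.
    have -> : w - p = (y - f p) - ((f v0 - v0) - (f p - p)).
      by apply/rowP => j; rewrite !mxE; ring.
    by apply: le_trans (ler_normB _ _) _; lra.
  have [_ _ /(_ w (le_lt_trans Kw rhor)) Lw] := lip _ v0r.
  have := min w (mem_set Kw).
  have -> : f w - y = (f w - w) - (f v0 - v0).
    by apply/rowP => j; rewrite !mxE; ring.
  have E : `|w - v0| = `|f v0 - y| by rewrite /w addrAC subrr add0r distrC.
  rewrite E in Lw; move=> H.
  have /eqP : `|f v0 - y| = 0.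
    by apply/eqP; rewrite eq_le normr_ge0 andbT; lra.
  rewrite normr_eq0 subr_eq0 => /eqP fv0; exists v0 => //.
  have : `|v0 - p| <= `|f v0 - f p| + `|(f v0 - v0) - (f p - p)|.
    have {1}-> : v0 - p = (f v0 - f p) - ((f v0 - v0) - (f p - p)).
      by apply/rowP => j; rewrite !mxE; ring.
    exact: ler_normB.
  by rewrite fv0 in Lp *; lra.
(* Cutting the ball down to the preimage of [W] makes the image of [V] exactly [W], which is
   open. *)
pose W := ball (f p) (rho / 2); pose V := ball p rho `&` (f @^-1` W).
have Vr v : V v -> `|v - p| < r.
  by move=> [+ _]; rewrite -ball_normE /= distrC => /lt_trans; apply.
have fV : f @` V = W.
  apply/seteqP; split=> [_ [v [_ Wv] <-] //|y Wy].
  have [|v vr fv] := surj y; first by move: Wy; rewrite /W -ball_normE /= distrC.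
  exists v => //; split; last by rewrite /preimage /= fv.
  by rewrite -ball_normE /= distrC.
have oW : open W by exact: ball_open.
have oV : open V.
  rewrite openE => v [Bv Wv]; apply: filterI.
    by apply: open_nbhs_nbhs; split=> //; exact: ball_open.
  have [Uv _ _] := lip v (Vr v (conj Bv Wv)).
  by apply: (smooth_on_continuous sf Uv); apply: open_nbhs_nbhs.
have Vp : V p.
  by split; [exact: ballxx|apply: ballxx; rewrite divr_gt0].
pose psi y := xget p [set x | V x /\ f x = y].
have psiP y : W y -> V (psi y) /\ f (psi y) = y.
  rewrite -fV => -[x Vx fx].
  exact: (@xgetPex _ p [set x | V x /\ f x = y] (ex_intro _ x (conj Vx fx))).
have psif v : V v -> psi (f v) = v.
  move=> Vv; have [Vq fq] := psiP (f v) Vv.2.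
  have := expand _ _ (Vr _ Vv) (Vr _ Vq).
  by rewrite fq subrr normr0 mulr0 normr_le0 subr_eq0 => /eqP.
have lipsi y z : W y -> W z -> `|psi z - psi y| <= 2 * `|z - y|.
  move=> /psiP[Vy fy] /psiP[Vz fz].
  by have := expand _ _ (Vr _ Vy) (Vr _ Vz); rewrite fy fz.
have dpsi y : W y -> differentiable psi y /\ 'J psi y = invmx ('J f (psi y)).
  move=> Wy; have [Vx fx] := psiP y Wy; set x := psi y in Vx fx *.
  have [Ux Jx _] := lip _ (Vr _ Vx); set B := invmx _.
  have dB : continuous (mulmxr B : 'rV[R]_n -> 'rV[R]_n).
    move=> z; apply: differentiable_continuous.
    have [+ _] := jacobian_mulmx B 0 z.
    by congr (differentiable _ _); apply/funext => v; rewrite addr0.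
  have [C [C0 CB]] : exists C : R, 0 < C /\ forall v : 'rV[R]_n, `|v *m B| <= C * `|v|.
    have [C C0 CB] := linear_lipschitz dB; exists C; split=> // v; exact: CB.
  have ef : forall e : R, 0 < e -> \forall h \near (0 : 'rV[R]_n),
      `|f (x + h) - f x - h *m 'J f x| <= e * `|h|.
    move=> e e0; have /diff_locallyP[_ /eqaddoP/(_ e e0)] := df Ux.
    apply: filterS => h H.
    have {}H : `|f (h + x) - (f x + 'd f x h)| <= e * `|h| by [].
    by rewrite diff_jacobian in H; [rewrite [x + h]addrC -addrA -opprD|exact: df].
  have E : psi \o shift y = cst (psi y) + mulmxr B +o_ (0 : 'rV[R]_n) id.
    apply/eqaddoP => e e0.
    (* [C] bounds multiplication by the inverse Jacobian, and 2 is the Lipschitz constant of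
       [psi]. *)
    pose e' := e / (C * 2); have e'0 : 0 < e' by rewrite divr_gt0 // mulr_gt0.
    have /nbhs_ballP[d /= d0 Hd] := ef e' e'0.
    have N : \forall k \near (0 : 'rV[R]_n), `|k| < d / 2 /\ W (y + k).
      apply: filterI.
        apply/nbhs_ballP; exists (d / 2); first by rewrite /= divr_gt0.
        by move=> k; rewrite -ball_normE /= sub0r normrN.
      have : \forall z \near y, W z by exact: open_nbhs_nbhs.
      rewrite (near_shift 0) /=; apply: filterS => k; by rewrite /= subr0 addrC.
    apply: filterS N => k [kd Wk].
    suff : `|psi (k + y) - (x + k *m B)| <= e * `|k| by [].
    rewrite [k + y]addrC; have [Vz fz] := psiP _ Wk; set z := psi (y + k) in Vz fz *.
    pose h := z - x.
    have hk : `|h| <= 2 * `|k| by have := lipsi _ _ Wy Wk; rewrite addrAC subrr add0r.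
    have /Hd : ball (0 : 'rV[R]_n) d h by rewrite -ball_normE /= sub0r normrN; lra.
    rewrite /= {1}/h subrKC fz fx [y + k]addrC addrK => H.
    have -> : z - (x + k *m B) = - ((k - h *m 'J f x) *m B).
      by rewrite mulmxBl mulmxK // opprB /h opprD addrA.
    rewrite normrN; apply: le_trans (CB _) _.
    have {}H : `|k - h *m 'J f x| <= e' * (2 * `|k|).
      by apply: le_trans H _; rewrite ler_wpM2l // ltW.
    have -> : e * `|k| = C * (e' * (2 * `|k|)).
      by rewrite /e'; field; rewrite gt_eqF.
    by rewrite ler_wpM2l // ltW.
  have U1 := diff_unique dB E.
  have dq : differentiable psi y.
    by apply/diff_locallyP; rewrite U1; exact: (conj dB E).
  split; first exact: dq.
  apply/row_matrixP => i; have e1 := diff_jacobian 'e_i dq; rewrite U1 in e1.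
  move: e1; generalize ('J psi y) => A e1.
  by rewrite !rowE -e1.
exists V, psi; rewrite fV; split=> //.
- by split=> // v /Vr/lip[].
- by move=> v /set_mem; exact: psif.
elim=> [|k IH].
  split=> // y /set_mem Wy; have [dy _] := dpsi _ Wy; exact: differentiable_continuous.
apply/class_C_coord => // j; split=> [y Wy|i].
  have [dy _] := dpsi _ Wy.
  apply: (@continuous_comp _ _ _ psi (fun w : 'rV[R]_n => w 0 j)).
    exact: differentiable_continuous.
  by move=> A; exact: coord_continuous.
(* The partial derivatives of [psi] are inverse Jacobian entries of f composed with [psi], so [psi]
   of class C^k makes them of class C^k. *)
have H : Ck k W ((fun x => invmx ('J f x) i j) \o psi).
  apply: (Ck_comp oW oV _ IH); first by move=> y /psiP[].
  apply: Ck_invmx => //; first by move=> v /Vr/lip[].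
  by move=> a b; apply: Ck_sub (sJ a b k) => v /Vr/lip[].
have dj y : W y -> is_derive y 'e_i (fun z => psi z 0 j) (invmx ('J f (psi y)) i j).
  move=> Wy; have [dy <-] := dpsi _ Wy.
  have := diff_derivable (v := 'e_i) dy => dv; split; last by rewrite jacobianE.
  by move/derivable_mxP: dv => /(_ 0 j).
split=> [y /dj[] //|].
by apply: Ck_eq H => // y /dj[_ ->].
Qed.

End InverseFunction.

(** * Charts and slices *)

Section Charts.
Variables (R : realType) (n : nat) (M : topologicalType).
Implicit Types (c d e : chart R n M) (x y : M).

Lemma chartK c x : chart_dom c x -> chart_inv c (c x) = x.
Proof. by move=> cx; apply: chart_mapK; exact: mem_set. Qed.

Lemma near_chart_dom c x : chart_dom c x -> \forall y \near x, chart_dom c y.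
Proof. by move=> cx; apply: open_nbhs_nbhs; split=> //; exact: chart_dom_open. Qed.

Lemma chart_continuous c x : chart_dom c x -> {for x, continuous c}.
Proof. by move=> cx; apply: chart_map_continuous; exact: mem_set. Qed.

Lemma chart_inv_continuous_at c x : chart_dom c x ->
  {for c x, continuous (chart_inv c)}.
Proof. by move=> cx; apply: chart_inv_continuous; apply: mem_set; exists x. Qed.

Lemma chart_inj c x y : chart_dom c x -> chart_dom c y -> c x = c y -> x = y.
Proof. by move=> cx cy E; rewrite -(chartK cx) E chartK. Qed.

(** Since [chart_inv] is total, its values make sense only on the chart's image; the witness [y]
    records that a nearby vector does come from the chart. *)
Lemma near_chart_inv c x (P : M -> Prop) : chart_dom c x ->
  (\forall y \near x, P y) ->
  \forall v \near c x, exists y, [/\ chart_dom c y, P y & c y = v].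
Proof.
move=> cx Px.
have N1 : \forall v \near c x, (c @` chart_dom c) v.
  by apply: open_nbhs_nbhs; split; [exact: chart_cod_open|exists x].
have N2 : \forall v \near c x, P (chart_inv c v).
  by apply: (chart_inv_continuous_at cx); rewrite chartK.
apply: filterS2 N1 N2 => v [y cy <-]; rewrite chartK // => Py.
by exists y.
Qed.

Lemma chart_image_open c (A : set M) : open A -> open (c @` (chart_dom c `&` A)).
Proof.
move=> oA; rewrite openE => _ [x [cx Ax] <-].
have /(near_chart_inv cx) : \forall y \near x, A y by exact: open_nbhs_nbhs.
by apply: filterS => v [y [cy Ay <-]]; exists y.
Qed.

Lemma chart_image2_open c d : open (c @` (chart_dom c `&` chart_dom d)).
Proof. by apply: chart_image_open; exact: chart_dom_open. Qed.

Variable S : smooth_manifold R n M.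

Lemma smooth_chart_atlas c : atlas S c -> smooth_chart S c.
Proof. by move=> Sc d Sd; split; exact: (atlas_smooth (s := S)). Qed.

(** A smooth chart is compared with charts of the atlas only, so near each point the transition is
    factored through an atlas chart there. *)
Lemma smooth_chart_transition c d : smooth_chart S c -> smooth_chart S d ->
  smooth_transition c d.
Proof.
move=> sc sd; apply: smooth_on_local; first exact: chart_image2_open.
move=> _ [x [cx dx] <-]; have [e Se ex] := atlas_cover S x.
have [[ce _] [_ ed]] := (sc e Se, sd e Se).
pose A := chart_dom d `&` chart_dom e.
have oA : open A by apply: openI; exact: chart_dom_open.
exists (c @` (chart_dom c `&` A)); split; first exact: chart_image_open.
  by exists x.
have H : smooth_on (c @` (chart_dom c `&` A))
    ((d \o chart_inv e) \o (e \o chart_inv c)).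
  have := @smooth_on_comp R n n n _ _ (e \o chart_inv c) (d \o chart_inv e)
    (@chart_image_open c _ oA) (@chart_image2_open e d).
  apply => //.
    by move=> _ [y [cy [dy ey]] <-]; rewrite /= chartK //; exists y.
  apply: smooth_on_sub ce; [exact: chart_image2_open|exact: chart_image_open|].
  by move=> _ [y [cy [dy ey]] <-]; exists y.
apply: smooth_on_eq H; first exact: chart_image_open.
by move=> _ [y [cy [dy ey]] <-]; rewrite /= !chartK.
Qed.

(** The source of all new charts: it serves once for the averaged map and once for an affine change
    of coordinates that straightens a fixed hyperplane. *)
Lemma chart_postcompose c (V : set 'rV[R]_n) (f f' : 'rV[R]_n -> 'rV[R]_n) :
  smooth_chart S c -> open V -> V `<=` c @` chart_dom c -> open (f @` V) ->
  {in V, cancel f f'} -> smooth_on V f -> smooth_on (f @` V) f' ->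
  exists c' : chart R n M, [/\ smooth_chart S c',
    chart_dom c' = [set x | chart_dom c x /\ V (c x)] &
    forall x, c' x = f (c x)].
Proof.
move=> sc oV Vc ofV fK sf sf'.
pose D := [set x | chart_dom c x /\ V (c x)].
have fK' v : V v -> f' (f v) = v by move=> Vv; apply: fK; exact: mem_set.
have codE : (f \o c) @` D = f @` V.
  apply/seteqP; split=> [_ [x [cx Vx] <-]|_ [v Vv <-]]; first by exists (c x).
  by have [x cx cv] := Vc _ Vv; exists x; rewrite /= ?cv //; split; rewrite ?cv.
have oD : open D.
  rewrite openE => x [cx Vx]; apply: filterI; first exact: near_chart_dom.
  by apply: (chart_continuous cx); exact: open_nbhs_nbhs.
have cf v : V v -> {for v, continuous f} by exact: smooth_on_continuous.
have cf' w : (f @` V) w -> {for w, continuous f'} by exact: smooth_on_continuous.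
have ocod : open ((f \o c) @` D) by rewrite codE.
have cmap : {in D, continuous (f \o c)}.
  move=> x /set_mem[cx Vx]; apply: continuous_comp; first exact: chart_continuous.
  exact: cf.
have cinv : {in (f \o c) @` D, continuous (chart_inv c \o f')}.
  rewrite codE => w /set_mem fVw; apply: continuous_comp; first exact: cf'.
  have [v Vv <-] := fVw; rewrite fK'//; have [x cx <-] := Vc _ Vv.
  exact: chart_inv_continuous_at.
have mapK : {in D, cancel (f \o c) (chart_inv c \o f')}.
  by move=> x /set_mem[cx Vx]; rewrite /= fK' // chartK.
pose c' := Chart oD ocod cmap cinv mapK.
exists c'; split=> // d Sd; have [cd dc] := sc d Sd; split.
  have := @smooth_on_comp R n n n (c' @` (chart_dom c' `&` chart_dom d))
    (c @` (chart_dom c `&` chart_dom d)) f' (d \o chart_inv c).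
  apply=> //; [exact: chart_image2_open..| |].
    by move=> _ [x [[cx Vx] dx] <-]; rewrite /= fK' //; exists x.
  apply: smooth_on_sub sf' => //; first exact: chart_image2_open.
  by move=> _ [x [[cx Vx] dx] <-]; exists (c x).
have := @smooth_on_comp R n n n (d @` (chart_dom d `&` chart_dom c'))
  V (c \o chart_inv d) f.
apply=> //; [exact: chart_image2_open| |].
  by move=> _ [x [dx [cx Vx]] <-]; rewrite /= chartK.
apply: smooth_on_sub dc; [exact: chart_image2_open..|].
by move=> _ [x [dx [cx Vx]] <-]; exists x.
Qed.

Lemma locally_compact_manifold x : exists2 K : set M, compact K & nbhs x K.
Proof.
have [c _ cx] := atlas_cover S x.
have : \forall v \near c x, (c @` chart_dom c) v.
  by apply: open_nbhs_nbhs; split; [exact: chart_cod_open|exists x].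
move/nbhs_closedballP => [r Br].
have sub : closed_ball (c x) r%:num `<=` c @` chart_dom c by exact: Br.
exists (chart_inv c @` closed_ball (c x) r%:num).
  apply: continuous_compact.
    apply: continuous_in_subspaceT => v /set_mem/sub cv.
    by apply: chart_inv_continuous; exact: mem_set.
  apply: bounded_closed_compact; last exact: closed_ball_closed.
  exists (r%:num + `|c x|); split; first exact: num_real.
  move=> N rN v; rewrite closed_ballE // /closed_ball_ /= => vr.
  apply: le_trans (ltW rN); rewrite -[v](subrK (c x)).
  by apply: le_trans (ler_normD _ _) _; rewrite lerD2r distrC.
have N1 := near_chart_dom cx.
have N2 : \forall y \near x, closed_ball (c x) r%:num (c y).
  apply: (chart_continuous cx).
  by apply: filterS (nbhsx_ballx (c x) r%:num _) => //; exact: subset_closed_ball.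
apply: filterS2 N1 N2 => y cy By; exists (c y) => //; exact: chartK.
Qed.

End Charts.

Lemma filter_forall_seq (T : Type) (I : eqType) (F : set_system T) (s : seq I)
    (P : I -> T -> Prop) : Filter F ->
  (forall i, i \in s -> \forall x \near F, P i x) ->
  \forall x \near F, forall i, i \in s -> P i x.
Proof.
move=> FF; elim: s => [|i s IH] H; first exact: filterE.
have N1 := H i (mem_head _ _).
have N2 : \forall x \near F, forall i, i \in s -> P i x.
  by apply: IH => j js; apply: H; rewrite inE js orbT.
apply: filterS2 N1 N2 => x Pi Ps j; rewrite inE => /orP[/eqP->//|]; exact: Ps.
Qed.

(** For infinite [A] the sets missing only finitely many points of [A] form a proper filter, and
    open singletons prevent it from having a cluster point. *)
Lemma compact_discrete_finite (T : choiceType) (A : set (discrete_topology T)) :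
  compact A -> finite_set A.
Proof.
move=> cA; apply: contrapT => infA.
pose F : set_system (discrete_topology T) := fun B => finite_set (A `\` B).
have FF : ProperFilter F.
  split; first by rewrite /F setD0.
  split=> [|B C FB FC|B C BC FB].
  - by rewrite /F setDT; exact: finite_set0.
  - by rewrite /F setDIr finite_setU.
  - by apply: sub_finite_set FB => x [Ax nC]; split=> // /BC.
have [|x [_ /(_ (~` [set x]) [set x])]] := cA F FF.
  by rewrite /F setDv; exact: finite_set0.
case=> [||y [//]].
- by apply: (sub_finite_set _ (finite_set1 x)) => y [_ /contrapT].
- exact: discrete_set1.
Qed.

(** * Local finiteness of a proper action *)

Section Slices.
Variables (R : realType) (n : nat) (M : topologicalType) (S : smooth_manifold R n M).
Variables (G : groupType) (a : left_action G M).
Hypotheses (a_cont : forall g, continuous (a g)) (a_proper : proper_action a).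

(** The preimage of K x K under the action map is compact, and so is its projection to the discrete
    group. *)
Lemma finite_return (K : set M) : compact K ->
  finite_set [set g : G | exists2 z, K z & K (a g z)].
Proof.
move=> cK; apply: (@compact_discrete_finite G).
have cKK : compact (K `*` K) by exact: compact_setX.
have /a_proper := cKK => cP.
have := @continuous_compact _ _ fst _ _ cP.
have cf : {within (fun p : discrete_topology G * M => (a p.1 p.2, p.2)) @^-1` (K `*` K),
    continuous (@fst (discrete_topology G) M)}.
  by apply: continuous_subspaceT => p; exact: cvg_fst.
move=> /(_ cf); congr (compact _).
apply/seteqP; split=> [_ [[g z] [/= Kg Kz] <-]|g [z Kz Kg]]; first by exists z.
by exists (g, z).
Qed.

(** Only finitely many elements return a compact neighbourhood to itself; those that move [x] are
    excluded one by one, by separating [x] from its image. *)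
Lemma slice x : finite_set [set g | a g x = x] /\
  exists2 U, nbhs x U & forall z g, U z -> U (a g z) -> a g x = x.
Proof.
have [K cK nK] := locally_compact_manifold S x.
have fK := finite_return cK; have Kx := nbhs_singleton nK.
split.
  apply: sub_finite_set fK => g /= gx; exists x => //; by rewrite gx.
have /choice[U HU] : forall g, exists U : set M, nbhs x U /\
    (a g x <> x -> forall z, U z -> ~ U (a g z)).
  move=> g; have [gx|gx] := pselect (a g x = x).
    by exists setT; split=> //; exact: filterT.
  have := manifold_hausdorff S; rewrite open_hausdorff => hM.
  have /hM[[A B] /= [Agx Bx] [oA oB /eqP AB]] : a g x != x by apply/eqP.
  exists (B `&` (a g @^-1` A)); split.
    apply: filterI.
      by apply: open_nbhs_nbhs; split=> //; exact: set_mem.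
    by apply: a_cont; apply: open_nbhs_nbhs; split=> //; exact: set_mem.
  move=> _ z [_ Ag] [Bg _]; have : (A `&` B) (a g z) by split.
  by rewrite AB.
have [s sE] := (finite_seqP _).1 fK.
exists (K `&` [set z | forall g, g \in s -> U g z]).
  by apply: filterI => //; apply: filter_forall_seq => g _; have [] := HU g.
move=> z g [Kz Uz] [Kg Ug]; apply: contrapT => gx.
have gs : g \in s.
  have : [set g : G | exists2 z, K z & K (a g z)] g by exists z.
  by rewrite sE.
by have [_ /(_ gx z (Uz _ gs))] := HU g; apply; exact: Ug.
Qed.

End Slices.

(** * Equivariant linear charts *)

Lemma jacobian_add (R : realType) m n (f g : 'rV[R]_m -> 'rV[R]_n) x :
  differentiable f x -> differentiable g x ->
  'J (fun v => f v + g v) x = 'J f x + 'J g x.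
Proof.
move=> df dg; have dfg : differentiable (f + g) x by exact: differentiableD.
apply/row_matrixP => i.
have e1 := diff_jacobian 'e_i dfg; have e2 := diff_jacobian 'e_i df.
have e3 := diff_jacobian 'e_i dg.
rewrite (diffD df dg) in e1.
have e4 : 'd f x 'e_i + 'd g x 'e_i = 'e_i *m 'J (fun v => f v + g v) x by exact: e1.
move: e2 e3 e4 {e1}; generalize ('d f x 'e_i); generalize ('d g x 'e_i).
generalize ('J (fun v => f v + g v) x); generalize ('J f x); generalize ('J g x).
by move=> A B C u v -> ->; rewrite !rowE mulmxDr.
Qed.

Lemma jacobian_sum (R : realType) m n (I : eqType) (r : seq I)
    (F : I -> 'rV[R]_m -> 'rV[R]_n) x :
  (forall i, i \in r -> differentiable (F i) x) ->
  differentiable (fun v => \sum_(i <- r) F i v) x /\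
  'J (fun v => \sum_(i <- r) F i v) x = \sum_(i <- r) 'J (F i) x.
Proof.
elim: r => [|i r IH] dF.
  have -> : (fun v => \sum_(i <- [::]) F i v) = (fun v => v *m (0 : 'M[R]_(m, n)) + 0).
    by apply/funext => v; rewrite big_nil mulmx0 addr0.
  by have [d1 ->] := jacobian_mulmx (0 : 'M[R]_(m, n)) 0 x; rewrite big_nil.
have dFi : differentiable (F i) x by apply: dF; exact: mem_head.
have [|dr Jr] := IH; first by move=> j jr; apply: dF; rewrite inE jr orbT.
have -> : (fun v => \sum_(j <- i :: r) F j v) =
    (fun v => F i v + (fun v => \sum_(j <- r) F j v) v).
  by apply/funext => v; rewrite big_cons.
by split; [exact: differentiableD|rewrite jacobian_add // Jr big_cons].
Qed.

Lemma jacobian_affine_comp (R : realType) m n p (f : 'rV[R]_m -> 'rV[R]_n)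
    (B : 'M[R]_(n, p)) b x : differentiable f x ->
  differentiable (fun v => f v *m B + b) x /\
  'J (fun v => f v *m B + b) x = 'J f x *m B.
Proof.
move=> df; have [dB JB] := jacobian_mulmx B b (f x).
have := jacobian_comp df dB; rewrite JB => E; split; last exact: E.
exact: (differentiable_comp df dB).
Qed.

Lemma jacobian_id (R : realType) n (x : 'rV[R]_n) : 'J (@id 'rV[R]_n) x = 1%:M.
Proof.
have [_ <-] := jacobian_mulmx (1%:M : 'M[R]_n) 0 x.
by congr jacobian; apply/funext => v; rewrite mulmx1 addr0.
Qed.

Section Linearization.
Variables (R : realType) (n : nat) (M : topologicalType) (S : smooth_manifold R n M).
Variables (G : groupType) (a : left_action G M).
Hypotheses (a_smooth : smooth_action S a) (a_proper : proper_action a).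

Lemma action_continuous g : continuous (a g).
Proof. by have [] := a_smooth g. Qed.

(** Bochner's linearization. The average intertwines the action with the matrices by reindexing, and
    its derivative at [p] is 1, so it is a local diffeomorphism. The matrices [J k] carry
    information only for [k] fixing [x]. *)
Lemma linear_chart x : exists (phi : chart R n M) (J : G -> 'M[R]_n),
  [/\ smooth_chart S phi, chart_dom phi x, phi x = 0 &
   forall k, a k x = x -> \forall y \near x,
     chart_dom phi (a k y) /\ phi (a k y) = phi y *m J k].
Proof.
have [fK _] := slice S action_continuous a_proper x.
(* Without repetitions, translation by an element of [K] permutes the list, as the reindexing of the
   average requires. *)
have [s sE] := (finite_seqP _).1 fK; pose K := undup s.
have inK k : k \in K <-> a k x = x.
  rewrite mem_undup.
  split=> [ks|kx]; first by have : [set` s] k by []; rewrite -sE.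
  by have : [set k | a k x = x] k by []; rewrite sE.
have uK : uniq K by exact: undup_uniq.
have K1 : 1%g \in K by apply/inK; exact: act1.
have KM k l : k \in K -> l \in K -> (k * l)%g \in K.
  by move=> /inK kx /inK lx; apply/inK; rewrite actM lx.
have KV k : k \in K -> (k^-1)%g \in K.
  by move=> /inK kx; apply/inK; rewrite -{1}kx -actM mulVg act1.
have [c Sc cx] := atlas_cover S x; pose p := c x.
pose kc k := c \o a k \o chart_inv c.
(* Where all summands of the average are defined in the chart [c]. *)
pose A := [set y | forall k, k \in K -> chart_dom c (a k y)].
have nA : \forall y \near x, forall k, k \in K -> chart_dom c (a k y).
  apply: filter_forall_seq => k /inK kx.
  have H : nbhs (a k x) (chart_dom c) by rewrite kx; exact: near_chart_dom.
  exact: (@action_continuous k x _ H).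
have oA : open A.
  rewrite openE => y Ay.
  have : \forall z \near y, forall k, k \in K -> chart_dom c (a k z).
    apply: filter_forall_seq => k kK.
    exact: (@action_continuous k y _ (near_chart_dom (Ay k kK))).
  by [].
pose U := c @` (chart_dom c `&` A).
have oU : open U by exact: chart_image_open.
have Up : U p by exists x => //; split=> //; exact: nbhs_singleton nA.
have kcE k y : chart_dom c y -> kc k (c y) = c (a k y).
  by move=> cy; rewrite /kc /= chartK.
have kcp k : k \in K -> kc k p = p by move=> /inK kx; rewrite kcE // kx.
have sk k : k \in K -> smooth_on U (kc k).
  move=> kK; have [_ /(_ c c Sc Sc)] := a_smooth k.
  have oC : open (a k @^-1` chart_dom c).
    apply: open_comp; last exact: chart_dom_open.
    by move=> y _; exact: action_continuous.
  apply: smooth_on_sub => //; first exact: chart_image_open.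
  by move=> _ [y [cy Ay] <-]; exists y => //; split=> //; exact: Ay.
have dk k : k \in K -> differentiable (kc k) p.
  by move=> kK; exact: smooth_on_differentiable oU (sk k kK) Up.
pose J k := 'J (kc k) p.
have JM k l : k \in K -> l \in K -> J (k * l)%g = J l *m J k.
  move=> kK lK.
  have dk' : differentiable (kc k) (kc l p) by rewrite kcp //; exact: dk.
  have := jacobian_comp (dk l lK) dk'; rewrite (kcp l lK) => <-.
  have E : \forall v \near p, kc (k * l)%g v = (kc k \o kc l) v.
    have := near_chart_inv cx nA; apply: filterS => v [y [cy Ay <-]].
    by rewrite /= !kcE ?actM //; exact: Ay.
  have [_ HJ] := jacobian_eq E (dk _ (KM _ _ kK lK)); exact: (esym HJ).
have J1 : J 1%g = 1%:M.
  rewrite -(jacobian_id p).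
  have E : \forall v \near p, kc 1%g v = v.
    have := near_chart_inv cx nA; apply: filterS => v [y [cy Ay <-]].
    by rewrite /= kcE // act1.
  have [_ HJ] := jacobian_eq E (dk _ K1); exact: (esym HJ).
pose N : R := (size K)%:R.
have N0 : N != 0 by rewrite pnatr_eq0; move: K1; case: (K).
(* F is the average over k of the maps J_k^-1 \o (k read in c); row vectors
   make J contravariant, J (k * l) = J l *m J k. *)
pose B k := N^-1 *: J (k^-1)%g.
pose F v := \sum_(k <- K) (kc k v *m B k + (- p *m B k)).
have Fp : F p = 0.
  by rewrite /F big1_seq // => k /= kK; rewrite kcp // mulNmx subrr.
have sF : smooth_on U F.
  (* [kc k] is smooth on [U] only for [k] in [K], whereas [smooth_on_sum] asks for all indices; the
     others are set to 0. *)
  pose F' k v := if k \in K then kc k v *m B k + (- p *m B k) else 0.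
  have : smooth_on U (fun v => \sum_(k <- K) F' k v).
    apply: smooth_on_sum => // k; case kK : (k \in K); rewrite /F' kK; last exact: smooth_on_cst.
    apply: smooth_on_add => //; last exact: smooth_on_cst.
    by apply: smooth_on_mulmx => //; exact: sk.
  apply: smooth_on_eq => // v _; apply: eq_big_seq => k kK; by rewrite /F' kK.
have JF : 'J F p = 1%:M.
  have dF k : k \in K -> differentiable (fun v => kc k v *m B k + (- p *m B k)) p.
    by move=> /dk/(jacobian_affine_comp (B k) (- p *m B k))[].
  have [_ E] := @jacobian_sum R n n G K _ p dF; apply: etrans E _.
  rewrite (eq_big_seq (fun=> N^-1 *: 1%:M)).
    have -> (r : seq G) (C : 'M[R]_n) : \sum_(k <- r) C = C *+ size r.
      by elim: r => [|k r IH]; rewrite ?big_nil // big_cons IH mulrS.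
    by rewrite -scaler_nat scalerA mulfV // scale1r.
  move=> k kK; have [_ E] := jacobian_affine_comp (B k) (- p *m B k) (dk k kK).
  apply: etrans E _; rewrite -/(J k) /B -scalemxAr -JM ?mulVg ?J1 //; exact: KV.
clearbody J.
have eqv l y : l \in K -> chart_dom c y -> A y -> F (c (a l y)) = F (c y) *m J l.
  move=> lK cy Ay; have cl : chart_dom c (a l y) by exact: Ay.
  pose H k := (c (a k y) - p) *m B k.
  have FE : F (c y) = \sum_(k <- K) H k.
    by apply: eq_bigr => k _; rewrite kcE // /H mulmxBl mulNmx.
  have -> : F (c (a l y)) = \sum_(k <- K) (H (k * l)%g *m J l).
    apply: eq_big_seq => k kK; rewrite kcE // -actM /H -mulmxA -mulmxDl.
    suff -> : B k = B (k * l)%g *m J l by [].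
    rewrite /B -scalemxAl -JM //; last by apply/KV/KM.
    by rewrite invgM mulgA mulgV mul1g.
  (* Substitution of [k * l] for [k] in the sum. *)
  rewrite FE mulmx_suml -(big_map (fun k => k * l)%g xpredT (fun k => H k *m J l)).
  apply: perm_big; apply: uniq_perm => //.
    by rewrite map_inj_uniq // => k k'; exact: mulIg.
  move=> k; apply/mapP/idP => [[k' k'K ->]|kK]; first exact: KM.
  by exists (k * l^-1)%g; [apply: KM => //; exact: KV|rewrite mulgVK].
have [V [psi [oV [Vp VU] oFV FK spsi]]] := inverse_function oU Up sF JF.
have Vcod : V `<=` c @` chart_dom c by move=> v /VU[y [cy _] <-]; exists y.
have sFV : smooth_on V F by apply: smooth_on_sub sF.
have [phi [sphi domE phiE]] :=
  chart_postcompose (smooth_chart_atlas Sc) oV Vcod oFV FK sFV spsi.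
have px : chart_dom phi x by rewrite domE.
exists phi, J; split=> //; first by rewrite phiE.
move=> k kx; have kK : k \in K by apply/inK.
have N1 : \forall y \near x, chart_dom phi (a k y).
  have H : nbhs (a k x) (chart_dom phi) by rewrite kx; exact: near_chart_dom.
  exact: (@action_continuous k x _ H).
have N2 := near_chart_dom cx.
by near=> y; split; [near: y|rewrite !phiE eqv //; near: y].
Unshelve. all: by end_near. Qed.

End Linearization.

(** A proper subspace has empty interior: differences move the neighbourhood to 0, where it contains
    small multiples of the basis vectors. *)
Lemma mulmx_near0 (R : realType) (n p : nat) (B : 'M[R]_(n, p))
    (b v0 : 'rV[R]_n) :
  (\forall v \near v0, (v - b) *m B = 0) -> B = 0.
Proof.
move=> H; have H0 := nbhs_singleton H.
have {}H : \forall h \near (0 : 'rV[R]_n), h *m B = 0.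
  have := H; rewrite (near_shift 0) /=; apply: filterS => h /=.
  by rewrite subr0 -addrA mulmxDl H0 addr0.
apply/row_matrixP => i; rewrite row0 rowE.
have /nbhs_ballP[d /= d0 Hd] := H.
have /Hd : ball (0 : 'rV[R]_n) d ((d / 2) *: 'e_i).
  rewrite -ball_normE /= sub0r normrN.
  apply: (@le_lt_trans _ _ (d / 2)); last by lra.
  apply/rV_norm_le; first by lra.
  move=> j; rewrite !mxE eqxx /= normrM ger0_norm ?ler_piMr //; try lra.
  by case: (j == i); rewrite ?normr1 ?normr0.
by rewrite /= -scalemxAl => /eqP; rewrite scaler_eq0 gt_eqF ?divr_gt0 //= => /eqP ->.
Qed.

(** * The rank of dg - 1 along the fixed set *)

Section LocalLinearity.
Variables (R : realType) (n : nat) (M : topologicalType) (S : smooth_manifold R n M).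
Variables (G : groupType) (a : left_action G M).
Hypotheses (a_smooth : smooth_action S a) (a_proper : proper_action a).

(* g is affine in a smooth chart near x; stating it without phi x = 0 lets the
   same chart serve at nearby fixed points. *)
Definition linear_at g x (r : nat) := exists (phi : chart R n M) (A : 'M[R]_n),
  [/\ smooth_chart S phi, chart_dom phi x, \rank (A - 1%:M) = r &
   \forall y \near x, chart_dom phi (a g y) /\
     phi (a g y) - phi x = (phi y - phi x) *m A].

Lemma linear_at_exists g x : a g x = x -> exists r, linear_at g x r.
Proof.
move=> gx; have [phi [J [sphi px p0 H]]] := linear_chart a_smooth a_proper x.
exists (\rank (J g - 1%:M)), phi, (J g); split=> //.
by rewrite p0; apply: filterS (H g gx) => y; rewrite !subr0.
Qed.

(** Subtracting the affine equation at the fixed point z from the one at y moves the base point to z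
    and keeps the matrix. *)
Lemma linear_at_near g x r : a g x = x -> linear_at g x r ->
  \forall z \near x, a g z = z -> linear_at g z r.
Proof.
move=> gx [phi [A [sphi px rA H]]].
have N1 := near_chart_dom px.
have N2 := H; rewrite -nbhs_nearE in N2; have {N2}N2 := nbhs_interior N2.
have N3 := H.
near=> z => gz; exists phi, A; split=> //; first by near: z.
have [_ E] : chart_dom phi (a g z) /\ phi (a g z) - phi x = (phi z - phi x) *m A.
  by near: z.
have Hz : \forall y \near z, chart_dom phi (a g y) /\
    phi (a g y) - phi x = (phi y - phi x) *m A by near: z.
rewrite gz in E; apply: filterS Hz => y [dy Ey]; split=> //.
by rewrite -[phi (a g y)](subrK (phi x)) Ey -addrA -[phi x - phi z]opprB E -mulmxBl opprB subrKA.
Unshelve. all: by end_near. Qed.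

Lemma linear_at_uniq g x r r' : a g x = x ->
  linear_at g x r -> linear_at g x r' -> r = r'.
Proof.
move=> gx [phi [A [sphi px <- H]]] [psi [B [spsi qx <- H']]].
have s1 := smooth_chart_transition sphi spsi.
have s2 := smooth_chart_transition spsi sphi.
pose t := psi \o chart_inv phi; pose t' := phi \o chart_inv psi.
have d1 : differentiable t (phi x).
  by apply: smooth_on_differentiable s1 _; [exact: chart_image2_open|exists x].
have d2 : differentiable t' (psi x).
  by apply: smooth_on_differentiable s2 _; [exact: chart_image2_open|exists x].
have tx : t (phi x) = psi x by rewrite /t /= chartK.
have d2' : differentiable t' (t (phi x)) by rewrite tx.
have TT' : 'J t (phi x) *m 'J t' (psi x) = 1%:M.
  have E := jacobian_comp d1 d2'; rewrite tx in E.
  rewrite -E -(jacobian_id (phi x)).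
  have nE : \forall v \near phi x, (t' \o t) v = v.
    have := near_chart_inv px (near_chart_dom qx); apply: filterS => v [y [py qy <-]].
    by rewrite /t' /t /= !chartK.
  have [_ HJ] := jacobian_eq nE (differentiable_comp d1 d2'); exact: (esym HJ).
(* The transition t conjugates A to B; differentiate at phi x. *)
have AT : A *m 'J t (phi x) = 'J t (phi x) *m B.
  pose al v := v *m A + (phi x - phi x *m A).
  have [da Ja] := jacobian_mulmx A (phi x - phi x *m A) (phi x).
  have ax : al (phi x) = phi x by rewrite /al addrC subrK.
  have d1' : differentiable t (al (phi x)) by rewrite ax.
  have E1 := jacobian_comp da d1'; rewrite Ja in E1.
  have {}E1 : 'J (t \o al) (phi x) = A *m 'J t (phi x).
    by apply: etrans E1 _; rewrite -/(al (phi x)) ax.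
  have [db E2] := jacobian_affine_comp B (psi x - psi x *m B) d1.
  have nE : \forall v \near phi x, t v *m B + (psi x - psi x *m B) = (t \o al) v.
    have HH : \forall y \near x, [/\ chart_dom phi (a g y) /\
       phi (a g y) - phi x = (phi y - phi x) *m A, chart_dom psi (a g y) /\
       psi (a g y) - psi x = (psi y - psi x) *m B & chart_dom psi y].
      have Q := near_chart_dom qx.
      by near=> y; split; near: y.
    have := near_chart_inv px HH.
    apply: filterS => v [y [py [[pg Eg] [qg Fg] qy] <-]].
    have -> : (t \o al) (phi y) = psi (a g y).
      suff E4 : al (phi y) = phi (a g y).
        by apply: etrans (congr1 t E4) _; rewrite /t /= chartK.
      rewrite /al -[phi (a g y)](subrK (phi x)) Eg mulmxBl; by rewrite addrA addrAC.
    rewrite /t /= chartK // -[psi (a g y)](subrK (psi x)) Fg mulmxBl.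
    by rewrite addrA addrAC.
  have [_ E3] := jacobian_eq nE db.
  by rewrite -E1 -E2; exact: E3.
move: TT' AT; generalize ('J t (phi x)); generalize ('J t' (psi x)) => T' T TT' AT.
have [uT _] := mulmx1_unit TT'.
have E : (A - 1%:M) *m T = T *m (B - 1%:M).
  by rewrite mulmxBl mulmxBr AT mul1mx mulmx1.
rewrite -(mxrankMfree (A - 1%:M) (B := T)) ?row_free_unit // E.
by rewrite eqmxMfull // row_full_unit.
Unshelve. all: by end_near. Qed.

(** The rank is locally constant on the fixed set and unique at each point, so the points of rank
    [r] are both open and closed in the component. *)
Lemma linear_at_component g x r : a g x = x -> linear_at g x r ->
  forall y, connected_component (fixed_points a g) x y -> linear_at g y r.
Proof.
move=> gx lx; set C := connected_component _ x.
have Cg y : C y -> a g y = y by move=> /connected_component_sub.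
(* The implications hold vacuously off the fixed set, so interiors can be taken in [M]. *)
pose P := [set y | a g y = y -> linear_at g y r].
pose Q := [set y | a g y = y -> exists2 r', r' <> r & linear_at g y r'].
have EP : C `&` [set y | linear_at g y r] = C `&` P°.
  apply/seteqP; split=> y [Cy ly]; split=> //.
    exact: (linear_at_near (Cg y Cy) ly).
  by apply: (nbhs_singleton ly); exact: Cg.
have EQ : C `&` [set y | linear_at g y r] = C `&` ~` Q°.
  apply/seteqP; split=> y [Cy ly]; split=> //.
    move=> /nbhs_singleton/(_ (Cg y Cy))[r' r'r ly'].
    exact/r'r/(linear_at_uniq (Cg y Cy) ly' ly).
  have [r' ly'] := linear_at_exists (Cg y Cy).
  have [<-//|r'r] := pselect (r' = r).
  case: ly; have := linear_at_near (Cg y Cy) ly'.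
  by apply: filterS => z lz gz; exists r' => //; exact: lz.
have cC : connected C by exact: component_connected.
have CE : C `&` [set y | linear_at g y r] = C.
  apply: cC.
  - by exists x; split=> //; exact: connected_component_refl.
  - by exists P°; first exact: open_interior.
  - by exists (~` Q°) => //; apply: open_closedC; exact: open_interior.
by move=> y; rewrite -CE => -[].
Qed.

Lemma linear_at0_near g x : a g x = x -> linear_at g x 0 -> \forall y \near x, a g y = y.
Proof.
move=> gx [phi [A [sphi px /eqP rA H]]].
move: rA; rewrite mxrank_eq0 subr_eq0 => /eqP A1.
have N := near_chart_dom px; apply: filterS2 N H => y py [pg].
by rewrite A1 mulmx1 => /addIr; exact: chart_inj.
Qed.

Hypothesis M_connected : connected [set: M].
Hypothesis a_effective : effective_action a.

(** The interior of the fixed set is closed: at a limit point y the element g is affine with some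
    matrix [A], and points near y around which g is the identity force [A = 1]. Connectedness and
    effectiveness conclude. *)
Lemma linear_at0 g x : a g x = x -> linear_at g x 0 -> g = 1%g.
Proof.
move=> gx /(linear_at0_near gx) nx; apply: a_effective.
pose O := [set y | a g y = y]°.
have cF : closed [set y | a g y = y].
  have hM := manifold_hausdorff S.
  move=> y cy; apply: hM => A B Ay By.
  have [z [gz [Bz Az]]] := cy _ (@filterI _ (nbhs y) _ _ _ By (action_continuous a_smooth Ay)).
  by exists z; split=> //; rewrite -[z]gz.
suff OT : O = setT.
  by move=> y; have : O y by [rewrite OT]; exact: nbhs_singleton.
apply: M_connected; first by exists x.
  by exists O; [exact: open_interior|rewrite setTI].
exists O; rewrite ?setTI // => y cOy.
have gy : a g y = y.
  by apply: cF => B /cOy[z [/nbhs_singleton Oz Bz]]; exists z.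
have [r [phi [A [sphi py rA H]]]] := linear_at_exists gy.
suff A0 : A - 1%:M = 0.
  by apply: linear_at0_near => //; exists phi, A; rewrite A0 mxrank0.
have := near_chart_dom py => N; have HN := @filterI _ (nbhs y) (nbhs_filter y) _ _ H N.
have [z [Oz Hz]] := cOy _ (nbhs_interior HN).
have [_ pz] := nbhs_singleton Hz.
apply: (@mulmx_near0 _ _ _ _ (phi y) (phi z)).
have := near_chart_inv pz (@filterI _ (nbhs z) (nbhs_filter z) _ _ Oz Hz).
apply: filterS => v [w [pw [/= gw [[_ E] _]] <-]].
by rewrite mulmxBr mulmx1 -E gw subrr.
Qed.

End LocalLinearity.

(** * Reflections *)

(** The rank normal form makes the kernel a coordinate hyperplane for the first coordinate; the
    transposition moves it to the last, which [submanifold] wants to vanish. *)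
Lemma rank1_kernel (F : fieldType) (n : nat) (B : 'M[F]_n.+1) : \rank B = 1%N ->
  exists2 T : 'M[F]_n.+1, T \in unitmx &
    forall v : 'rV[F]_n.+1, v *m B = 0 <-> (v *m T) 0 ord_max = 0.
Proof.
move=> rB; exists (col_ebase B *m tperm_mx ord0 ord_max).
  by rewrite unitmx_mul col_ebase_unit unitmx_perm.
move=> v; rewrite -{1}(mulmx_ebase B) rB !mulmxA -xcolE [xcol _ _ _ _ _]mxE tpermR.
move: (v *m col_ebase B) => u.
split=> [E|u0].
  have {}E : u *m pid_mx 1 = 0 :> 'rV_n.+1.
    by rewrite -[LHS](mulmxK (row_ebase_unit B)) E mul0mx.
  have /rowP/(_ 0) := E; rewrite !mxE (bigD1 0) //= big1 => [|i i0].
    by rewrite addr0 !mxE /= mulr1.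
  by move: i0; rewrite -val_eqE /= !mxE => /negbTE ->; rewrite mulr0.
suff -> : u *m pid_mx 1 = 0 :> 'rV_n.+1 by rewrite mul0mx.
apply/rowP => j; rewrite !mxE big1 // => i _; rewrite !mxE.
have [-> |i0] := eqVneq i 0; first by rewrite u0 mul0r.
have -> : (i < 1)%N = false by move: i0; rewrite ltnS leqn0 -val_eqE /= => /negbTE.
by rewrite andbF mulr0.
Qed.

Lemma image_right_inverse (T : topologicalType) (f f' : T -> T) (V : set T) :
  cancel f f' -> cancel f' f -> continuous f' -> open V -> open (f @` V).
Proof.
move=> fK f'K cf' oV.
have -> : f @` V = f' @^-1` V.
  apply/seteqP; split=> [_ [v Vv <-]|w Vw]; first by rewrite /= fK.
  by exists (f' w).
by apply: open_comp => // w _; exact: cf'.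
Qed.

Lemma connected_chart_segment (R : realType) (n : nat) (M : topologicalType)
    (phi : chart R n M) (u w : 'rV[R]_n) :
  (forall t : R, 0 <= t <= 1 -> (phi @` chart_dom phi) (u + t *: (w - u))) ->
  connected ((fun t : R => chart_inv phi (u + t *: (w - u))) @` `[0, 1]).
Proof.
move=> H; apply: connected_continuous_connected; first exact: segment_connected.
apply: continuous_in_subspaceT => t; rewrite inE /= in_itv /= => t01.
apply: (@continuous_comp _ _ _ (fun t : R => u + t *: (w - u)) (chart_inv phi)).
  apply: continuousD; first exact: cst_continuous.
  by apply: continuousZl; exact: id.
by apply: chart_inv_continuous; apply: mem_set; exact: H.
Qed.

Section Reflections.
Variables (R : realType) (n : nat) (M : topologicalType) (S : smooth_manifold R n M).
Variables (G : groupType) (a : left_action G M).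
Hypotheses (a_smooth : smooth_action S a) (a_proper : proper_action a).

(** At every point of the component the fixed set is a hyperplane in an affine chart. As
    [submanifold] speaks of the component alone, it must also be shown that all fixed points in this
    chart belong to it. *)
Lemma linear_at1_reflection g x : a g x = x -> linear_at S a g x 1 -> reflection S a g.
Proof.
move=> gx lx; exists x => //.
have lC := linear_at_component a_smooth a_proper gx lx.
set C := connected_component _ x in lC *.
(* In dimension 0 no matrix has rank 1. *)
case: n S a_smooth lx lC => [|m] S' a_smooth' lx lC.
  have [phi [A [_ _ + _]]] := lx.
  by have := rank_leq_row (A - 1%:M); rewrite leqn0 => /eqP ->.
exists m; rewrite ?addn1 //; split=> // y Cy.
have gy : a g y = y by exact: (connected_component_sub Cy).
have [phi [A [sphi py rA H]]] := lC y Cy.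
have [T uT TE] := rank1_kernel rA.
pose P z := chart_dom phi (a g z) /\ phi (a g z) - phi y = (phi z - phi y) *m A.
(* A ball is convex, so segments from its centre remain in the chart. *)
have /nbhs_ballP[e /= e0 He] := near_chart_inv py (H : \forall z \near y, P z).
pose V : set 'rV[R]_m.+1 := ball (phi y) e.
have oV : open V by exact: ball_open.
have Vcod : V `<=` phi @` chart_dom phi by move=> v /He[z [pz _ <-]]; exists z.
pose f (v : 'rV[R]_m.+1) : 'rV[R]_m.+1 := (v - phi y) *m T.
pose f' (w : 'rV[R]_m.+1) : 'rV[R]_m.+1 := w *m invmx T + phi y.
have fK : cancel f f' by move=> v; rewrite /f /f' mulmxK // subrK.
have f'K : cancel f' f by move=> v; rewrite /f /f' addrK mulmxKV.
have sf U : open U -> smooth_on U f.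
  move=> oU; apply: smooth_on_mulmx => //; apply: smooth_on_add => //.
    exact: smooth_on_id.
  exact: smooth_on_cst.
have sf' U : open U -> smooth_on U f'.
  move=> oU; apply: smooth_on_add => //; last exact: smooth_on_cst.
  by apply: smooth_on_mulmx => //; exact: smooth_on_id.
have cf' : continuous f'.
  by move=> v; apply: (@smooth_on_continuous _ _ _ setT f' v) => //; apply: sf'; exact: openT.
have ofV : open (f @` V) by exact: image_right_inverse fK f'K cf' oV.
have fKV : {in V, cancel f f'} by move=> v _; exact: fK.
have [c [sc domc cE]] := chart_postcompose sphi oV Vcod ofV fKV (sf _ oV) (sf' _ ofV).
have Pdom z : chart_dom phi z -> V (phi z) -> P z.
  move=> pz /He[z' [pz' Pz' E]]; by rewrite -(chart_inj pz' pz E).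
have fixE z : chart_dom phi z -> V (phi z) ->
    a g z = z <-> (phi z - phi y) *m (A - 1%:M) = 0.
  move=> pz Vz; have [pgz E] := Pdom z pz Vz.
  rewrite mulmxBr mulmx1 -E.
  split=> [->|/eqP]; first by rewrite subrr.
  rewrite subr_eq0 => /eqP/addIr; exact: chart_inj.
(* The segment from [phi y] to [phi z] lies in the kernel direction, so it consists of fixed points
   and joins [z] to [y] in the fixed set. *)
have fixC z : chart_dom phi z -> V (phi z) -> a g z = z -> C z.
  move=> pz Vz gz.
  have seg t : 0 <= t <= 1 -> V (phi y + t *: (phi z - phi y)).
    move=> /andP[t0 t1]; move: Vz; rewrite /V -ball_normE /= => Vz.
    rewrite opprD addNKr normrN normrZ ger0_norm //.
    by apply: le_lt_trans Vz; rewrite distrC ler_piMl.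
  have cS := @connected_chart_segment R m.+1 M phi (phi y) (phi z).
  have {}cS := cS (fun t t01 => Vcod _ (seg t t01)).
  set D := _ @` _ in cS.
  have Dy : D y.
    by exists 0; rewrite /= ?in_itv /= ?lexx ?ler01 // scale0r addr0 chartK.
  have Dz : D z.
    by exists 1; rewrite /= ?in_itv /= ?lexx ?ler01 // scale1r subrKC chartK.
  have Dfix : D `<=` fixed_points a g.
    move=> _ [t t01 <-]; rewrite /= in_itv /= in t01; have Vt := seg t t01.
    have [q pq qE] := Vcod _ Vt; rewrite -qE chartK // /fixed_points /=.
    rewrite -qE in Vt; apply/fixE => //; rewrite qE addrAC subrr add0r -scalemxAl.
    by have [/(_ gz) -> _] := fixE z pz Vz; rewrite scaler0.
  rewrite /C (same_connected_component Cy).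
  exact: (connected_component_max Dy Dfix cS) Dz.
have coordE z : chart_dom phi z -> V (phi z) -> a g z = z <-> c z 0 ord_max = 0.
  by move=> pz Vz; rewrite (fixE z pz Vz) TE cE.
have dom2 z : chart_dom c z -> chart_dom phi z /\ V (phi z) by rewrite domc.
exists c; split=> //.
  by rewrite domc; split=> //; exact: ballxx.
apply/seteqP; split=> [_ [z [cz Cz] <-]|_ [[z cz <-] cz0]].
  have [pz Vz] := dom2 z cz.
  split; first by exists z.
  move=> i mi; have -> : i = ord_max.
    by apply/val_inj/eqP; rewrite /= eqn_leq mi -ltnS ltn_ord.
  by apply/coordE => //; exact: (connected_component_sub Cz).
have [pz Vz] := dom2 z cz; exists z => //; split=> //.
by apply: fixC => //; apply/coordE => //; exact: cz0.
Qed.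

End Reflections.

(** * Generation *)

(** Removing one proper kernel leaves an open set, nonempty by [mulmx_near0], to which the induction
    applies. *)
Lemma avoid_kernels (R : realType) (n p : nat) (s : seq 'M[R]_(n, p))
    (O : set 'rV[R]_n) : open O -> O !=set0 -> (forall B, B \in s -> B != 0) ->
  exists2 v, O v & forall B, B \in s -> v *m B <> 0.
Proof.
elim: s O => [|B s IH] O oO [v0 Ov0] s0; first by exists v0.
pose O' := O `&` [set v | v *m B != 0].
have oT : open [set: 'rV[R]_n] by exact: openT.
have oO' : open O'.
  rewrite openE => v [Ov vB]; apply: filterI; first exact: open_nbhs_nbhs.
  have cB : {for v, continuous (fun w : 'rV[R]_n => w *m B)}.
    have sB := smooth_on_mulmx B oT (smooth_on_id oT).
    exact: smooth_on_continuous sB I.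
  have H := cvgr_neq0 (v *m B).
  exact: (H _ (nbhs v) _ _ cB vB).
have [||v [Ov vB] vs] := IH O' oO'.
- apply: contrapT => O'0; have /eqP := s0 B (mem_head _ _); apply.
  apply: (@mulmx_near0 _ _ _ _ 0 v0).
  have : \forall v \near v0, O v by exact: open_nbhs_nbhs.
  apply: filterS => v Ov; rewrite subr0; apply: contrapT => /eqP vB.
  by apply: O'0; exists v.
- by move=> C Cs; apply: s0; rewrite inE Cs orbT.
exists v => // C; rewrite inE => /orP[/eqP->|]; [exact/eqP|exact: vs].
Qed.

(* A segment from u to w avoids ker B as soon as w is not in ker B + R u, the
   kernel of B *m cokermx (u *m B), which is proper when B has rank > 1. *)
Lemma coker_neq0 (F : fieldType) (n : nat) (B : 'M[F]_n) (u : 'rV[F]_n) :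
  (1 < \rank B)%N -> B *m cokermx (u *m B) != 0.
Proof.
apply: contraTneq => /eqP; rewrite -submxE => /mxrankS rB.
by rewrite -leqNgt; apply: leq_trans rB (rank_leq_row _).
Qed.

Lemma segment_avoids (R : realType) (n : nat) (B : 'M[R]_n) (u w : 'rV[R]_n) (t : R) :
  u *m B <> 0 -> w *m (B *m cokermx (u *m B)) <> 0 -> (u + t *: (w - u)) *m B <> 0.
Proof.
(* Modulo the line spanned by [u *m B] only the multiple [t] of [w *m B] survives; hence [t = 0],
   and then [u *m B = 0]. *)
move=> uB wB E; have : (u + t *: (w - u)) *m B *m cokermx (u *m B) = 0.
  by rewrite E mul0mx.
rewrite mulmxDl -scalemxAl mulmxBl mulmxDl mulmx_coker add0r -scalemxAl mulmxBl.
rewrite mulmx_coker subr0 -mulmxA => /eqP; rewrite scaler_eq0 => /orP[/eqP t0|/eqP //].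
by apply: uB; rewrite -E t0 scale0r addr0.
Qed.

Section Generation.
Variables (R : realType) (n : nat) (M : topologicalType) (S : smooth_manifold R n M).
Variables (G : groupType) (a : left_action G M).
Hypotheses (a_smooth : smooth_action S a) (a_proper : proper_action a).
Hypothesis M_connected : connected [set: M].
Hypothesis a_effective : effective_action a.

Lemma isotropy_seq x : exists K : seq G, forall k, k \in K <-> a k x = x.
Proof.
have [fK _] := slice S (action_continuous a_smooth) a_proper x.
have [K KE] := (finite_seqP _).1 fK; exists K => k.
split=> [kK|kx]; first by have : [set` K] k by []; rewrite -KE.
by have : [set k | a k x = x] k by []; rewrite KE.
Qed.

(** The last clause confines the isotropy of nearby points to [K], so that finitely many matrices
    govern all fixed points near [x]. *)
Lemma linear_chart_slice x : exists (phi : chart R n M) (J : G -> 'M[R]_n) (K : seq G),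
  [/\ smooth_chart S phi, chart_dom phi x, phi x = 0,
   (forall k, k \in K -> a k x = x /\ linear_at S a k x (\rank (J k - 1%:M))) &
   \forall y \near x,
     (forall k, k \in K -> chart_dom phi (a k y) /\ phi (a k y) = phi y *m J k) /\
     (forall k, a k y = y -> k \in K)].
Proof.
have [phi [J [sphi px p0 H]]] := linear_chart a_smooth a_proper x.
have [K KE] := isotropy_seq x.
have [_ [U nU HU]] := slice S (action_continuous a_smooth) a_proper x.
exists phi, J, K; split=> //.
  move=> k /KE kx; split=> //; exists phi, (J k); split=> //.
  by rewrite p0; apply: filterS (H k kx) => y; rewrite !subr0.
have N1 : \forall y \near x, forall k, k \in K ->
    chart_dom phi (a k y) /\ phi (a k y) = phi y *m J k.
  by apply: filter_forall_seq => k /KE; exact: H.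
apply: filterS2 nU N1 => y Uy Hy; split=> // k ky; apply/KE.
by apply: (HU y) => //; rewrite ky.
Qed.

Definition free_point z := forall g, a g z = z -> g = 1%g.

(** In linear coordinates nontrivial isotropy means lying in one of finitely many kernels, all
    proper by [linear_at0]. *)
Lemma free_points_dense (x : M) (N : set M) : nbhs x N -> exists2 z, N z & free_point z.
Proof.
move=> nN; have [phi [J [K [sphi px p0 lJ H]]]] := linear_chart_slice x.
have := near_chart_inv px (@filterI _ (nbhs x) (nbhs_filter x) _ _ nN H).
set Q := (X in \forall v \near _, X v) => nQ.
pose s := [seq J k - 1%:M | k <- K & k != 1%g].
have [||B Bs|v /interior_subset[z [pz [Nz [Hz zK]] <-]] vs] :=
    @avoid_kernels R n n s Q°.
- exact: open_interior.
- by exists (phi x).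
- move: Bs => /mapP[k]; rewrite mem_filter => /andP[k1 kK] ->.
  apply: contra k1 => /eqP J0; apply/eqP; have [kx] := lJ k kK.
  rewrite J0 mxrank0.
  exact: (linear_at0 a_smooth a_proper M_connected a_effective kx).
exists z => // g gz; have gK := zK g gz; apply: contrapT => /eqP g1.
apply: (vs (J g - 1%:M)); first by apply/mapP; exists g; rewrite // mem_filter g1.
have [_ E] := Hz g gK; by rewrite mulmxBr mulmx1 -E gz subrr.
Qed.

Lemma free_point_orbit g z : free_point z -> free_point (a g z).
Proof.
move=> fz k kz; have : a (g^-1 * k * g)%g z = z.
  by rewrite !actM kz -actM mulVg act1.
move=> /fz/(congr1 (fun h => g * h * g^-1)%g).
by rewrite !mulgA mulgV mul1g -mulgA mulgV !mulg1 mulgV.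
Qed.

Variables (rho : M -> M) (H : set G).
Hypotheses (rho_cont : continuous rho) (rho_orbit : forall x, exists g, rho x = a g x).
Hypothesis rho_inv : forall g x, rho (a g x) = rho x.
Hypotheses (H1 : H 1%g) (HM : forall g h, H g -> H h -> H (g * h)%g).
Hypotheses (HV : forall g, H g -> H g^-1%g) (Hrefl : forall g, reflection S a g -> H g).

Definition saturation : set M := [set y | exists2 h, H h & a h (rho y) = y].
Local Notation W := saturation.

(** Write [rho y = a g y]. The element [h * g] takes the point [a g^-1 (rho z)], which is near [y]
    by continuity, to [z], also near [y]; by the slice property it fixes [y]. *)
Lemma near_translate_retract y :
  \forall z \near y, forall h, a h (rho z) = z -> a h (rho y) = y.
Proof.
have [_ [U nU HU]] := slice S (action_continuous a_smooth) a_proper y.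
have [g gy] := rho_orbit y.
have g0y : a g^-1%g (rho y) = y by rewrite gy -actM mulVg act1.
have cg : {for y, continuous (a g^-1%g \o rho)}.
  by apply: continuous_comp; [exact: rho_cont|exact: action_continuous].
have N : \forall z \near y, U (a g^-1%g (rho z)).
  by apply: cg; rewrite /= g0y.
apply: filterS2 nU N => z Uz Ugz h hz.
rewrite gy -actM; apply: (HU _ _ Ugz).
by rewrite -actM -mulgA mulgV mulg1 hz.
Qed.

(** The element of [H] belonging to a nearby point of [W] serves the limit point itself. *)
Lemma closed_saturation : closed W.
Proof.
move=> y /(_ _ (near_translate_retract y))[z [[h Hh hz] zy]].
by exists h => //; exact: zy.
Qed.

(** Whatever carries [rho z] to [z] also carries [rho q] to [q], as [h] does, so it differs from [h]
    by an isotropy element of [q]. *)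
Lemma saturation_near q : W q -> (forall g, a g q = q -> H g) -> \forall z \near q, W z.
Proof.
move=> [h Hh hq] isoH; apply: filterS (near_translate_retract q) => z zq.
have [k kz] := rho_orbit z.
have kz' : a k^-1%g (rho z) = z by rewrite kz -actM mulVg act1.
exists k^-1%g => //; have kq := zq _ kz'.
have : H (k^-1 * h^-1)%g.
  by apply: isoH; rewrite actM -{1}hq -[a h^-1%g _]actM mulVg act1.
by move=> /HM/(_ Hh); rewrite -mulgA mulVg mulg1.
Qed.

(** Two free points near [x] are joined by a broken line through a generic point [w] of the ball. On
    it the elements of [K] outside [H] have no fixed points, so membership in [W] propagates. *)
Lemma saturation_open x : W x -> \forall y \near x, W y.
Proof.
move=> Wx; have [phi [J [K [sphi px p0 lJ HP]]]] := linear_chart_slice x.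
have /nbhs_ballP[e /= e0 He] := near_chart_inv px HP.
pose V : set 'rV[R]_n := ball (phi x) e.
have oV : open V by exact: ball_open.
pose N := [set y | chart_dom phi y /\ V (phi y)].
have nN y : N y -> \forall z \near y, N z.
  move=> [py Vy]; apply: filterI; first exact: near_chart_dom.
  by apply: (chart_continuous py); exact: open_nbhs_nbhs.
have Nx : N x by split=> //; exact: ballxx.
have VN v : V v -> exists2 y, N y & phi y = v.
  by move=> Vv; have [y [py _ yv]] := He v Vv; exists y => //; split; rewrite ?yv.
have NP y : N y -> (forall k, k \in K -> chart_dom phi (a k y) /\
     phi (a k y) = phi y *m J k) /\ (forall k, a k y = y -> k \in K).
  move=> [py /He[z [pz Pz zy]]]; by rewrite -(chart_inj pz py zy).
have fixE k y : N y -> k \in K -> phi y *m (J k - 1%:M) = 0 -> a k y = y.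
  move=> Ny kK; have [/(_ k kK)[pk E] _] := NP y Ny; rewrite mulmxBr mulmx1 -E.
  by move=> /eqP; rewrite subr_eq0 => /eqP; apply: chart_inj => //; case: Ny.
have segment_stays u w : V u -> V w ->
    (forall t k, 0 <= t <= 1 -> k \in K -> ~ H k ->
       (u + t *: (w - u)) *m (J k - 1%:M) <> 0) ->
    forall t0 t1, 0 <= t0 <= 1 -> 0 <= t1 <= 1 ->
      W (chart_inv phi (u + t0 *: (w - u))) -> W (chart_inv phi (u + t1 *: (w - u))).
  move=> Vu Vw avoid.
  have seg t : 0 <= t <= 1 -> V (u + t *: (w - u)).
    move=> /andP[t0 t1]; move: Vu Vw; rewrite /V -ball_normE /= => Vu Vw.
    (* Convexity of the ball: a convex combination is bounded by the larger of the two norms. *)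
    have -> : phi x - (u + t *: (w - u)) = (1 - t) *: (phi x - u) + t *: (phi x - w).
      by apply/rowP => j; rewrite !mxE; ring.
    apply: le_lt_trans (ler_normD _ _) _; rewrite !normrZ !ger0_norm ?subr_ge0 //.
    set A := `|_| in Vu *; set B := `|_| in Vw *.
    have [tA|tA] := leP A B.
      have : (1 - t) * A <= (1 - t) * B by rewrite ler_wpM2l // subr_ge0.
      by lra.
    have : t * B <= t * A by rewrite ler_wpM2l // ltW.
    by lra.
  have cS := @connected_chart_segment R n M phi u w.
  have {}cS := cS (fun t t01 => let: ex_intro2 y Ny yE := VN _ (seg t t01) in
     ex_intro2 _ _ y (proj1 Ny) yE).
  set D := _ @` _ in cS.
  have DN q : D q -> N q /\ exists2 t, 0 <= t <= 1 & phi q = u + t *: (w - u).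
    move=> [t t01 <-]; rewrite /= in_itv /= in t01.
    have [y Ny yE] := VN _ (seg t t01); have [py _] := Ny.
    by rewrite -yE chartK //; split=> //; exists t => //; rewrite yE.
  move=> t0 t1 t01 t11 Wt0.
  have Dt t : 0 <= t <= 1 -> D (chart_inv phi (u + t *: (w - u))).
    by move=> t01'; exists t => //=; rewrite in_itv.
  (* [W] is closed everywhere, and open along the segment because isotropy there lies in [H]. *)
  have : D `&` W = D.
    apply: cS; first by exists (chart_inv phi (u + t0 *: (w - u))); split=> //; exact: Dt.
    - exists W°; first exact: open_interior.
      apply/seteqP; split=> q [Dq Wq]; split=> //; last exact: nbhs_singleton Wq.
      apply: saturation_near => // g gq; have [Nq [t t01' qE]] := DN q Dq.
      have [gP gK] := NP q Nq; have kK := gK g gq.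
      apply: contrapT => nHg; apply: (avoid t g) => //.
      by rewrite -qE mulmxBr mulmx1; have [_ <-] := gP g kK; rewrite gq subrr.
    - by exists W => //; exact: closed_saturation.
  by move=> DW; have : D (chart_inv phi (u + t1 *: (w - u))) by [exact: Dt]; rewrite -DW => -[].
have rank2 k : k \in K -> ~ H k -> (1 < \rank (J k - 1%:M)%R)%N.
  move=> kK nHk; have [kx lk] := lJ k kK.
  move: lk; case E : (\rank _) => [|[|r]] // lk.
    by case: nHk; rewrite (linear_at0 a_smooth a_proper M_connected a_effective kx lk).
  by case: nHk; apply: Hrefl; exact: linear_at1_reflection lk.
have free_moves k y : N y -> free_point y -> k \in K -> ~ H k ->
    phi y *m (J k - 1%:M) <> 0.
  by move=> Ny fy kK nHk /(fixE k y Ny kK)/fy k1; apply: nHk; rewrite k1.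
(* The map [a h \o rho] fixes [x], takes values in [W] and preserves free points; applied to a free
   point close to [x] it gives a starting point. *)
have [z0 [N0 W0] f0] : exists2 z, N z /\ W z & free_point z.
  have [h Hh hx] := Wx.
  have ch : {for x, continuous (a h \o rho)}.
    by apply: continuous_comp; [exact: rho_cont|exact: action_continuous].
  have nh : \forall z \near x, N (a h (rho z)).
    by apply: ch; rewrite /= hx; exact: nN.
  have [z Nz fz] := free_points_dense nh; have [g gz] := rho_orbit z.
  exists (a h (rho z)); last by rewrite gz -actM; exact: free_point_orbit.
  by split=> //; exists h => //; rewrite rho_inv gz rho_inv -gz.
have free_W y : N y -> free_point y -> W y.
  move=> Ny fy; pose u := phi z0; pose v := phi y.
  pose s := [seq k <- K | `[< ~ H k >]].
  pose B (u : 'rV[R]_n) k := (J k - 1%:M) *m cokermx (u *m (J k - 1%:M)).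
  have sP k : k \in s <-> k \in K /\ ~ H k.
    by rewrite mem_filter; split=> [/andP[/asboolP]|[kK /asboolP ->]].
  (* The vertex [w] must suit both ends, since each end has its own subspaces to avoid. *)
  have [|C|w Vw ws] := @avoid_kernels R n n (map (B u) s ++ map (B v) s) V oV.
  - by exists (phi x); exact: ballxx.
  - rewrite mem_cat => /orP[]/mapP[k /sP[kK nHk] ->]; exact: coker_neq0 (rank2 k kK nHk).
  have Buw k : k \in s -> w *m B u k <> 0.
    by move=> ks; apply: ws; rewrite mem_cat map_f.
  have Bvw k : k \in s -> w *m B v k <> 0.
    by move=> ks; apply: ws; rewrite mem_cat [X in _ || X]map_f ?orbT.
  have i0 : 0 <= (0 : R) <= 1 by rewrite lexx ler01.
  have i1 : 0 <= (1 : R) <= 1 by rewrite lexx ler01.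
  have W1 : W (chart_inv phi (u + 1 *: (w - u))).
    apply: (segment_stays u w N0.2 Vw _ 0) => //.
      move=> t k _ kK nHk; apply: segment_avoids; first exact: free_moves.
      by apply: Buw; apply/sP.
    by rewrite scale0r addr0 chartK //; case: N0.
  have W2 : W (chart_inv phi (v + 1 *: (w - v))).
    by move: W1; rewrite !scale1r !subrKC.
  (* The second segment is run backwards, from [w] at parameter 1 to [v] at parameter 0. *)
  have := segment_stays v w Ny.2 Vw _ 1 0 i1 i0 W2.
  rewrite scale0r addr0 chartK; last by case: Ny.
  apply=> t k _ kK nHk; apply: segment_avoids; first exact: free_moves.
  by apply: Bvw; apply/sP.
apply: filterS (nN x Nx) => y Ny; apply: closed_saturation => A nA.
have := free_points_dense (@filterI _ (nbhs y) (nbhs_filter y) _ _ nA (nN y Ny)).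
by case=> z [Az Nz] fz; exists z; split=> //; exact: free_W.
Qed.

Theorem generated_by_reflections g : H g.
Proof.
(* The empty space is connected too; effectiveness then makes the group trivial. *)
have [[x _]|M0] := pselect (exists x : M, True); last first.
  suff -> : g = 1%g by [].
  by apply: a_effective => x; case: M0; exists x.
have WT : W = setT.
  apply: M_connected.
  (* [rho] is idempotent because it is constant on orbits. *)
  - have [k kx] := rho_orbit x; exists (rho x), 1%g => //.
    by rewrite act1 kx rho_inv -kx.
  - exists W; last by rewrite setTI.
    by rewrite openE => y Wy; exact: saturation_open.
  - by exists W; [exact: closed_saturation|rewrite setTI].
have [z _ fz] := free_points_dense (@filterT _ (nbhs x) _).
have [h Hh hz] : W z by rewrite WT.
have [k Hk kz] : W (a g z) by rewrite WT.
rewrite rho_inv in kz.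
have : a (h * (k^-1 * g))%g z = z by rewrite !actM -kz -[a k^-1%g _]actM mulVg act1.
move=> /fz E.
have -> : g = (k * h^-1)%g.
  by apply: (mulgI k^-1%g); apply: (mulgI h); rewrite E mulKg mulgV.
by apply: HM => //; exact: HV.
Qed.

End Generation.

Theorem theorem1 (R : realType) (n : nat) (M : topologicalType)
    (S : smooth_manifold R n M) (M_connected : connected [set: M])
    (G : groupType) (a : left_action G M)
    (a_smooth : smooth_action S a) (a_proper : proper_action a)
    (a_effective : effective_action a)
    (q_section : exists s : orbit_space a -> M,
      continuous s /\ cancel s (@orbit_map G M a)) :
  generated_subgroup [set r : G | reflection S a r] = [set: G].
Proof.
have [s [cs sK]] := q_section; pose rho := s \o @orbit_map G M a.
have orbitP x y : orbit_map a x = orbit_map a y <-> exists g, a g x = y.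
  split=> [/eqquotP/asboolP//|gxy]; exact/eqquotP/asboolP.
have rho_cont : continuous rho.
  move=> x; apply: continuous_comp; last exact: cs.
  exact: pi_continuous.
have rho_orbit x : exists g, rho x = a g x.
  have /orbitP[g gx] : orbit_map a x = orbit_map a (rho x) by rewrite /rho /= sK.
  by exists g.
have rho_inv g x : rho (a g x) = rho x.
  by rewrite /rho /=; congr s; apply/esym/orbitP; exists g.
apply/seteqP; split=> // g _ H [[H1 HD] Hrefl].
(* [group_closed] supplies the unit and closure under division; inverses and products are recovered
   from these. *)
have HV h : H h -> H (h^-1)%g.
  move=> Hh; have := HD 1%g h H1 (mem_set Hh).
  by rewrite div1g => /set_mem.
have HM h k : H h -> H k -> H (h * k)%g.
  move=> Hh Hk; have := HD h (k^-1)%g (mem_set Hh) (mem_set (HV _ Hk)).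
  by rewrite invgK => /set_mem.
exact: (generated_by_reflections a_smooth a_proper M_connected a_effective
  rho_cont rho_orbit rho_inv (set_mem H1) HM HV Hrefl).
Qed.
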